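(* Let $n\geq 4$. Then $Aut(F_n)$ is generated by $W_n$ together with $\eta$, and the following is a presentation of $Aut(F_n)$: the generators are the elements of $W_n$ together with one additional symbol $\eta$, and the defining relations are \begin{enumerate} \item $\eta^2=1$; \item $(\sigma_{12}\eta)^3=1$; \item $(\eta\tau_i)^2=1$ for all $i>2$; \item $(\eta\sigma_{ij})^2=1$ for all $i,j>2$ (with $i\neq j$); \item $((\eta\tau_1)^2\tau_2)^2=1$; \item $(\eta\sigma_{13}\tau_2\eta\sigma_{12})^4=1$; \item $\sigma_{12}\eta\sigma_{13}\tau_2\eta\sigma_{12}(\sigma_{23}\eta\sigma_{13}\tau_2\eta)^2=1$; \item $(\sigma_{14}\sigma_{23}\eta)^4=1$; \item all relations holding in $W_n$ (e.g. the multiplication table of $W_n$, or any presentation of $W_n$). \end{enumerate} That is, the homomorphism from the abstract group with these generators and relations to $Aut(F_n)$, sending each element of $W_n$ to itself and $\eta$ to the automorphism $\eta$, is an isomorphism.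
   Context: $F_n$ is the free group on fixed generators $a_1,\ldots,a_n$, and $Aut(F_n)$ is its automorphism group, with group product given by composition of automorphisms. $W_n\leq Aut(F_n)$ is the subgroup of automorphisms that permute the generators and possibly invert some of them (the signed permutations of $\{a_1,\dots,a_n\}$). For $1\le i\le n$, $\tau_i\in W_n$ is the automorphism with $a_i\mapsto a_i^{-1}$ and $a_j\mapsto a_j$ for $j\neq i$. For $i\neq j$, $\sigma_{ij}\in W_n$ is the automorphism with $a_i\mapsto a_j$, $a_j\mapsto a_i$, $a_k\mapsto a_k$ for $k\neq i,j$. The automorphism $\eta$ (an involution) is defined by $a_1\mapsto a_2^{-1}a_1$, $a_2\mapsto a_2^{-1}$, and $a_k\mapsto a_k$ for $k>2$. *)

(* Defs.v *)
From Stdlib Require Import Relations.Relation_Operators.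
From mathcomp Require Import all_boot all_fingroup.
Set Implicit Arguments. Unset Strict Implicit. Unset Printing Implicit Defensive.

(* ---------- The free group F_n on a_1..a_n (0-based: a_{i+1} <-> i : 'I_n) *)
(* A letter (i, b) is a_i if b = false and a_i^{-1} if b = true. *)
Definition letter (n : nat) := ('I_n * bool)%type.
Definition inv_letter n (x : letter n) : letter n := (x.1, ~~ x.2).

Definition reduce n (w : seq (letter n)) : seq (letter n) :=
  foldr (fun x acc => match acc with
                      | y :: acc' => if y == inv_letter x then acc' else x :: acc
                      | [::] => [:: x] end) [::] w.

Definition word_inv n (w : seq (letter n)) := rev (map (@inv_letter n) w).

Definition endo (n : nat) := 'I_n -> seq (letter n).

Definition apply_endo n (f : endo n) (w : seq (letter n)) : seq (letter n) :=
  reduce (flatten (map (fun x : letter n =>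
            if x.2 then word_inv (f x.1) else f x.1) w)).

Definition comp n (f g : endo n) : endo n := fun i => apply_endo f (g i).
Definition id_endo n : endo n := fun i => [:: (i, false)].

Definition feq n (f g : endo n) : Prop := forall i, reduce (f i) = reduce (g i).

Definition is_aut n (f : endo n) : Prop :=
  exists g : endo n, feq (comp f g) (@id_endo n) /\ feq (comp g f) (@id_endo n).

(* ---------- W_n: signed permutations. (s, e) is a_i |-> a_{s i}^{(-1)^{e i}} *)
Definition wn (n : nat) := ({perm 'I_n} * {ffun 'I_n -> bool})%type.
Definition w_endo n (w : wn n) : endo n := fun i => [:: (w.1 i, w.2 i)].
Definition w_inv n (w : wn n) : wn n :=
  (w.1^-1, [ffun j => w.2 (w.1^-1 j)])%g.

Definition tau n (i : 'I_n) : wn n := (1%g, [ffun j => j == i]).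
Definition sigma n (i j : 'I_n) : wn n := (tperm i j, [ffun _ => false]).

Definition eta_endo n : endo n := fun k =>
  if val k == 0 then [:: (insubd k 1, true); (k, false)]
  else if val k == 1 then [:: (k, true)]
  else [:: (k, false)].

Inductive gen (n : nat) := GW of wn n | GEta.
Arguments GEta {n}.

(* words in the generators and their inverses: (g, true) stands for g^{-1} *)
Definition gword n := seq (gen n * bool).

Definition eval_gen n (x : gen n * bool) : endo n :=
  match x with
  | (GW w, false) => w_endo w
  | (GW w, true) => w_endo (w_inv w)
  | (GEta, _) => @eta_endo n   (* eta is an involution: eta^{-1} = eta *)
  end.

Definition eval_word n (w : gword n) : endo n :=
  foldr (fun x acc => comp (eval_gen x) acc) (@id_endo n) w.

Definition gW n (w : wn n) : gen n * bool := (GW w, false).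
Definition gE n : gen n * bool := (GEta, false).
Definition wpow n (w : gword n) (k : nat) : gword n := flatten (nseq k w).

Section Idx.
Variables (n : nat) (hn : 3 < n).
Definition i1 : 'I_n := Ordinal (ltn_trans (isT : 0 < 3) hn).
Definition i2 : 'I_n := Ordinal (ltn_trans (isT : 1 < 3) hn).
Definition i3 : 'I_n := Ordinal (ltn_trans (isT : 2 < 3) hn).
Definition i4 : 'I_n := Ordinal hn.
End Idx.

(* the defining relators (indices 0-based: i1 = a_1, ..., i4 = a_4) *)
Definition is_relator n (hn : 3 < n) (r : gword n) : Prop :=
  let s12 := gW (sigma (i1 hn) (i2 hn)) in
  let s13 := gW (sigma (i1 hn) (i3 hn)) in
  let s14 := gW (sigma (i1 hn) (i4 hn)) in
  let s23 := gW (sigma (i2 hn) (i3 hn)) in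
  let t1 := gW (tau (i1 hn)) in
  let t2 := gW (tau (i2 hn)) in
  let e := @gE n in
     (r = [:: e; e])
  \/ (r = wpow [:: s12; e] 3)
  \/ (exists i : 'I_n, 2 <= i /\ r = wpow [:: e; gW (tau i)] 2)
  \/ (exists i j : 'I_n, [/\ 2 <= i, 2 <= j, i != j &
                          r = wpow [:: e; gW (sigma i j)] 2])
  \/ (r = wpow (wpow [:: e; t1] 2 ++ [:: t2]) 2)
  \/ (r = wpow [:: e; s13; t2; e; s12] 4)
  \/ (r = [:: s12; e; s13; t2; e; s12] ++ wpow [:: s23; e; s13; t2; e] 2)
  \/ (r = wpow [:: s14; s23; e] 4)
  \/
      (all (fun x : gen n * bool => if x.1 is GW _ then true else false) r
       /\ feq (eval_word r) (@id_endo n)).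

Inductive pres_step n (hn : 3 < n) : gword n -> gword n -> Prop :=
  | ps_free (u v : gword n) (x : gen n * bool) :
      pres_step hn (u ++ [:: x; (x.1, ~~ x.2)] ++ v) (u ++ v)
  | ps_rel (u v r : gword n) :
      is_relator hn r -> pres_step hn (u ++ r ++ v) (u ++ v).

(* w represents the identity of the presented group
   (i.e. w lies in the normal closure of the relators in the free group) *)
Definition pres_trivial n (hn : 3 < n) (w : gword n) : Prop :=
  clos_refl_sym_trans _ (@pres_step n hn) w [::].

(* Main.v *)
(** The relators make the presented group [G] generated by [W_n] and elements acting as [x |-> x y],
    subject to Steinberg-type relations. Products of these with [y] fixed are the Whitehead elements:
    one for each cut of the set of the [2n] letters and the base point, with a multiplier [y] separated
    from its inverse by the cut.

    Injectivity is peak reduction. The total length of the images of the basis changes, under a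
    Whitehead element, by the number of turns that cross the cut minus the number of occurrences of the
    multiplier. The first number is submodular in the cut; so if two Whitehead elements applied to [g]
    do not increase the length and one of them decreases it, then uncrossing the cuts gives a path in
    the Cayley graph between the two results all of whose interior vertices are shorter than [g].
    Hence every element of [G] descends to [W_n] through shorter and shorter elements, and one that
    acts trivially, being shortest, lies in [W_n] already.

    Surjectivity is Nielsen's method: a basis that no elementary move shortens, or makes
    lexicographically smaller at equal length, has no letter that is cancelled completely in a product,
    so it consists of the free generators and their inverses. *)
Require Import Defs.
From HB Require Import structures.
From Stdlib Require Import Relations.Relation_Operators.
From mathcomp Require Import all_boot all_fingroup generic_quotient zify.
From mathcomp Require boolp.
Set Implicit Arguments.
Unset Strict Implicit.
Unset Printing Implicit Defensive.

(** The base point makes cuts measure words rather than cyclic words, and so automorphisms rather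
    than outer ones: a word is a closed path at [None], and its two ends count as turns.

    The two halves multiply on opposite sides. On the left, a Whitehead element acts on the words
    [act g x], and the change of length is read from their turns. On the right, a transvection
    multiplies one basis word by another, which is a Nielsen move.

    The obstacle in uncrossing is a pair of disjoint cuts, each separating the multiplier of the
    other from its inverse. The commuting square need not descend there, and a cut has to take over
    another multiplier instead. This costs a signed permutation, which is why edges carry a factor
    from [W_n].

    Both halves see the group only through [steinberg] and [steinberg_action]. The relators on [eta]
    mention only the first few generators; transitivity of [W_n] on tuples of letters of distinct
    index spreads their consequences to all letters, with four indices needed for the transvections
    that share none. *)

Notation "x ^!" := (inv_letter x) (at level 2, left associativity, format "x ^!").

(** * Free groups as reduced words *)

Section FreeGroup.
Variable n : nat.
Implicit Types (x y : letter n) (u v w : seq (letter n)).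

Lemma inv_letterK : involutive (@inv_letter n).
Proof. by case=> i b; rewrite /inv_letter /= negbK. Qed.

Lemma inv_letter_inj : injective (@inv_letter n).
Proof. exact: inv_inj inv_letterK. Qed.

Lemma inv_letter_eq x y : (x^! == y^!) = (x == y).
Proof. exact: inj_eq inv_letter_inj x y. Qed.

Lemma inv_letter_eqLR x y : (x^! == y) = (x == y^!).
Proof. by rewrite -inv_letter_eq inv_letterK. Qed.

Lemma inv_letter_neq x : (x^! == x) = false.
Proof. by case: x => i b; rewrite /inv_letter xpair_eqE /=; case: b; rewrite andbF. Qed.

Lemma neq_inv_letter x : (x == x^!) = false.
Proof. by rewrite eq_sym inv_letter_neq. Qed.

Lemma same_index x y : x.1 = y.1 -> x = y \/ x = y^!.
Proof. by case: x y => [i []] [j []] /= ->; auto. Qed.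

Definition push x w :=
  if w is y :: w' then if y == x^! then w' else x :: w else [:: x].

Definition reduced w := sorted (fun x y => y != x^!) w.

Lemma reduce_cons x w : reduce (x :: w) = push x (reduce w).
Proof. by rewrite /reduce /=; case: (foldr _ _ w). Qed.

Arguments reduce : simpl never.

Lemma reduce_foldr w : reduce w = foldr push [::] w.
Proof. by elim: w => // x w IH; rewrite reduce_cons IH. Qed.

Lemma reduced_push x w : reduced w -> reduced (push x w).
Proof.
case: w => //= y w; case: ifP => [_ /path_sorted // | /negbT yx].
by rewrite /reduced /= yx.
Qed.

Lemma reduced_reduce w : reduced (reduce w).
Proof. by rewrite reduce_foldr; elim: w => //= x w; apply: reduced_push. Qed.

Lemma reduced_tail x w : reduced (x :: w) -> reduced w.
Proof. exact: path_sorted. Qed.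

Lemma reduce_id w : reduced w -> reduce w = w.
Proof.
elim: w => // x w IH xw; rewrite reduce_cons IH ?(reduced_tail xw)//.
by case: w xw {IH} => //= y w /andP[/negPf-> _].
Qed.

Lemma push_inv x w : reduced w -> push x (push x^! w) = w.
Proof.
case: w => [|y w] /=; first by rewrite eqxx.
rewrite inv_letterK; case: eqP => [->|_]; last by rewrite /= eqxx.
by case: w => //= z w /andP[/negPf -> _].
Qed.

Lemma reduce_catr u v : reduce (u ++ reduce v) = reduce (u ++ v).
Proof.
elim: u => [|x u IH] /=; first by rewrite reduce_id ?reduced_reduce.
by rewrite !reduce_cons IH.
Qed.

Lemma reduce_catl u v : reduce (reduce u ++ v) = reduce (u ++ v).
Proof.
elim: u => // x u IH; rewrite !(reduce_cons, cat_cons) -IH.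
case: (reduce u) => //= y w; case: eqP => [->|_]; rewrite ?reduce_cons //.
by rewrite push_inv ?reduced_reduce.
Qed.

Lemma word_invK : involutive (@word_inv n).
Proof.
move=> w; rewrite /word_inv map_rev revK -map_comp map_id_in // => x _ /=.
exact: inv_letterK.
Qed.

Lemma word_inv_cons x w : word_inv (x :: w) = word_inv w ++ [:: x^!].
Proof. by rewrite /word_inv /= rev_cons cats1. Qed.

Lemma size_word_inv w : size (word_inv w) = size w.
Proof. by rewrite size_rev size_map. Qed.

Lemma reduced_word_inv w : reduced w -> reduced (word_inv w).
Proof.
rewrite /reduced /word_inv rev_sorted sorted_map.
apply: sub_sorted => x y /=; rewrite inv_letterK. by rewrite eq_sym inv_letter_eqLR.
Qed.

Lemma reduce_word_invl w : reduce (word_inv w ++ w) = [::].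
Proof.
elim: w => // x w IH; rewrite word_inv_cons -catA -reduce_catr /=.
rewrite !reduce_cons -{2}(inv_letterK x) push_inv ?reduced_reduce //.
by rewrite reduce_catr.
Qed.

Lemma reduce_word_invr w : reduce (w ++ word_inv w) = [::].
Proof. by rewrite -{1}(word_invK w) reduce_word_invl. Qed.

Record fgroup := FGroup { fword :> seq (letter n); fwordP : reduced fword }.

HB.instance Definition _ := [isSub for fword].
HB.instance Definition _ := [Choice of fgroup by <:].

Definition fg_of w := FGroup (reduced_reduce w).

Lemma fg_ofP (a : fgroup) : fg_of a = a.
Proof. by apply: val_inj; rewrite /= reduce_id // fwordP. Qed.

Definition fg_mul (a b : fgroup) := fg_of (a ++ b).
Definition fg_inv (a : fgroup) := fg_of (word_inv a).

Fact fg_mulA : associative fg_mul.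
Proof. by move=> a b c; apply: val_inj; rewrite /= reduce_catr reduce_catl catA. Qed.
Fact fg_mul1 : left_id (fg_of [::]) fg_mul.
Proof. exact: fg_ofP. Qed.
Fact fg_mulr1 : right_id (fg_of [::]) fg_mul.
Proof. by move=> a; rewrite /fg_mul cats0 fg_ofP. Qed.
Fact fg_mulV : left_inverse (fg_of [::]) fg_inv fg_mul.
Proof. by move=> a; apply: val_inj; rewrite /= reduce_catl reduce_word_invl. Qed.
Fact fg_mulrV : right_inverse (fg_of [::]) fg_inv fg_mul.
Proof. by move=> a; apply: val_inj; rewrite /= reduce_catr reduce_word_invr. Qed.

HB.instance Definition _ :=
  isGroup.Build fgroup fg_mulA fg_mul1 fg_mulr1 fg_mulV fg_mulrV.

End FreeGroup.

Local Open Scope group_scope.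

Section FreeGroupTheory.
Variable n : nat.
Implicit Types (x y : letter n) (u v w : seq (letter n)) (a b : fgroup n).

Lemma fg_of_cat u v : fg_of (u ++ v) = fg_of u * fg_of v.
Proof. by apply: val_inj; rewrite /= reduce_catl reduce_catr. Qed.

Lemma fg_of_inv u : fg_of (word_inv u) = (fg_of u)^-1.
Proof.
apply/esym/mulg1_eq; rewrite -fg_of_cat.
by apply: val_inj; rewrite /= reduce_word_invr.
Qed.

Lemma fg_of_reduce u : fg_of (reduce u) = fg_of u.
Proof. by apply: val_inj; rewrite /= reduce_id ?reduced_reduce. Qed.

Lemma fg_of_nil : fg_of [::] = 1 :> fgroup n. Proof. by []. Qed.

Definition fgen x : fgroup n := fg_of [:: x].

Lemma fgenV x : fgen x^! = (fgen x)^-1.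
Proof. by rewrite -fg_of_inv. Qed.

Lemma fword1 : fword (1 : fgroup n) = [::]. Proof. by []. Qed.

Lemma fword_gen x : fword (fgen x) = [:: x]. Proof. by []. Qed.

Lemma fwordM a b : fword (a * b) = reduce (a ++ b). Proof. by []. Qed.

Lemma fwordV a : fword a^-1 = word_inv a.
Proof. by rewrite [LHS]reduce_id // reduced_word_inv ?fwordP. Qed.

Lemma fg_of_prod u : fg_of u = \prod_(x <- u) fgen x.
Proof. by elim: u => [|x u IH]; rewrite (big_nil, big_cons) // -IH -fg_of_cat. Qed.

Lemma fg_prod a : a = \prod_(x <- a) fgen x.
Proof. by rewrite -fg_of_prod fg_ofP. Qed.

Lemma size_reduce u : size (reduce u) <= size u.
Proof.
elim: u => // x u IH; rewrite reduce_cons.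
by case: (reduce u) IH => //= y w; case: ifP => //=; lia.
Qed.

Lemma size_fgM a b : size (a * b) <= size a + size b.
Proof. by rewrite -size_cat fwordM size_reduce. Qed.

Lemma size_fgV a : size a^-1 = size a.
Proof. by rewrite fwordV size_word_inv. Qed.

Lemma size_fg_eq0 a : (size a == 0) = (a == 1).
Proof. by rewrite size_eq0 -(inj_eq val_inj). Qed.

Section Morphism.
Variables (H : groupType) (f : letter n -> H).
Hypothesis fV : forall x, f x^! = (f x)^-1.

Lemma prod_reduce u : \prod_(x <- reduce u) f x = \prod_(x <- u) f x.
Proof.
elim: u => // x u IH; rewrite reduce_cons big_cons -IH.
case: (reduce u) => [|y w] /=; first by rewrite big_cons.
by case: eqP => [->|_]; rewrite !big_cons // fV mulVKg.
Qed.

Definition fg_lift a : H := \prod_(x <- a) f x.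

Lemma fg_liftM a b : fg_lift (a * b) = fg_lift a * fg_lift b.
Proof. by rewrite /fg_lift fwordM prod_reduce big_cat. Qed.

Lemma fg_lift_of u : fg_lift (fg_of u) = \prod_(x <- u) f x.
Proof. exact: prod_reduce. Qed.

Lemma fg_lift_gen x : fg_lift (fgen x) = f x.
Proof. by rewrite /fg_lift fword_gen big_seq1. Qed.

End Morphism.

Lemma morph1_group (H K : groupType) (f : H -> K) :
  {morph f : x y / x * y} -> f 1 = 1.
Proof. by move=> fM; apply: (mulgI (f 1)); rewrite -fM !mulg1. Qed.

Lemma morphV_group (H K : groupType) (f : H -> K) :
  {morph f : x y / x * y} -> {morph f : x / x^-1}.
Proof.
by move=> fM x; apply/esym/mulg1_eq; rewrite -fM mulgV morph1_group.
Qed.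

Lemma fg_morph_prod (H : groupType) (f : fgroup n -> H) a :
  {morph f : x y / x * y} -> f a = \prod_(x <- a) f (fgen x).
Proof.
move=> fM; rewrite {1}[a]fg_prod.
by elim: (fword a) => [|x w IH]; rewrite !(big_nil, big_cons) ?morph1_group // fM IH.
Qed.

Lemma eq_fg_morph (H : groupType) (f g : fgroup n -> H) :
  {morph f : x y / x * y} -> {morph g : x y / x * y} ->
  (forall i, f (fgen (i, false)) = g (fgen (i, false))) -> f =1 g.
Proof.
move=> fM gM fg a; rewrite (fg_morph_prod a fM) (fg_morph_prod a gM).
apply: eq_bigr => -[i [|]] _ //.
by rewrite -[(i, true)]/((i, false)^!) fgenV !morphV_group // fg.
Qed.

End FreeGroupTheory.

(** * Signed permutations *)

Section SignedPerm.
Variable n : nat.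
Implicit Types (x y : letter n) (w : wn n) (i j : 'I_n).

Fact wl_key : unit. Proof. by []. Qed.
(** Locked so that simplification keeps the action folded and the rewrite rules below apply. *)
Definition wl : wn n -> letter n -> letter n :=
  locked_with wl_key (fun w x => (w.1 x.1, w.2 x.1 (+) x.2)).
Lemma wl_pairE w x : wl w x = (w.1 x.1, w.2 x.1 (+) x.2).
Proof. by rewrite /wl unlock. Qed.
Definition wone : wn n := (1, [ffun=> false]).
(** Permutations compose from left to right in MathComp; the order chosen here makes [wl] a left
    action. *)
Definition wmul w1 w2 : wn n := (w2.1 * w1.1, [ffun i => w2.2 i (+) w1.2 (w2.1 i)]).

Lemma wlM w1 w2 x : wl (wmul w1 w2) x = wl w1 (wl w2 x).
Proof. by rewrite !wl_pairE /= permM ffunE addbA [X in X (+) _]addbC. Qed.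

Lemma wl1 x : wl wone x = x.
Proof. by case: x => i b; rewrite !wl_pairE /= perm1 ffunE. Qed.

Lemma wlV w x : wl w (wl (w_inv w) x) = x.
Proof. by case: x => i b; rewrite !wl_pairE /= permKV ffunE addbA addbb. Qed.

Lemma wlVK w x : wl (w_inv w) (wl w x) = x.
Proof. by case: x => i b; rewrite !wl_pairE /= ffunE !permK addbA addbb. Qed.

Lemma wl_inv w x : wl w x^! = (wl w x)^!.
Proof. by rewrite !wl_pairE /inv_letter /= addbN. Qed.

Lemma wl_inj w : injective (wl w).
Proof. exact: can_inj (wlVK w). Qed.

Lemma wl_fst w x y : ((wl w x).1 == (wl w y).1) = (x.1 == y.1).
Proof. by rewrite !wl_pairE (inj_eq perm_inj). Qed.

Lemma wn_ext w1 w2 : wl w1 =1 wl w2 -> w1 = w2.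
Proof.
case: w1 w2 => [s1 e1] [s2 e2] E; congr pair.
  by apply/permP => i; have := E (i, false); rewrite !wl_pairE => -[].
by apply/ffunP => i; have := E (i, false); rewrite !wl_pairE !addbF => -[].
Qed.

Lemma wl_tau i x : wl (tau i) x = (x.1, (x.1 == i) (+) x.2).
Proof. by rewrite !wl_pairE /= perm1 ffunE. Qed.

Lemma wl_sigma i j x :
  wl (sigma i j) x = (if x.1 == i then j else if x.1 == j then i else x.1, x.2).
Proof.
rewrite !wl_pairE /= ffunE; congr pair.
by case: tpermP => [->|->|/eqP/negPf-> /eqP/negPf->]; rewrite ?eqxx //; case: eqP.
Qed.

(** For letters of different index this is the quarter turn [x |-> y |-> x^! |-> y^! |-> x], the
    counterpart of a Weyl element in a Steinberg group. *)
Definition wswap x y : wn n :=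
  (tperm x.1 y.1, [ffun i => if i == x.1 then x.2 (+) y.2
                             else (i == y.1) && ~~ (x.2 (+) y.2)]).

Lemma wl_swapl x y : wl (wswap x y) x = y.
Proof.
by case: x y => [i b] [j c]; rewrite !wl_pairE /= ffunE eqxx tpermL; case: b; case: c.
Qed.

Lemma wl_swapr x y : x.1 != y.1 -> wl (wswap x y) y = x^!.
Proof.
case: x y => [i b] [j c] /= ij; rewrite !wl_pairE /= ffunE eqxx tpermR eq_sym (negPf ij).
by case: b; case: c.
Qed.

Lemma wl_swap_out x y z : z.1 != x.1 -> z.1 != y.1 -> wl (wswap x y) z = z.
Proof.
case: z => k d /= kx ky; rewrite !wl_pairE /= ffunE (negPf kx) (negPf ky) tpermD //.
  by rewrite eq_sym.
by rewrite eq_sym.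
Qed.

Lemma wl_swap x y z : wl (wswap x y) z =
  if z.1 == x.1 then (y.1, x.2 (+) y.2 (+) z.2)
  else if z.1 == y.1 then (x.1, ~~ (x.2 (+) y.2 (+) z.2)) else z.
Proof.
case: z => k d; rewrite !wl_pairE /= ffunE; case: tpermP => [->|->|/eqP/negPf-> /eqP/negPf->] //.
  by rewrite eqxx.
by rewrite eqxx; case: eqP => [->|] //; rewrite addNb.
Qed.

(** The four-cycle of a quarter turn may be started at any of its letters. *)
Lemma wswap_rot x y : x.1 != y.1 -> wswap x y = wswap y^! x.
Proof.
move=> xy; apply/wn_ext => -[k d]; rewrite !wl_swap /=.
case: x y xy => [i b] [j c] /= ij; case: (eqVneq k i) => [->|_]; last first.
  by case: eqP => // _; case: b c d => [] [] [].
by rewrite (negPf ij); case: b c d => [] [] [].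
Qed.

Lemma wl_swapJ w x y z :
  wl w (wl (wswap x y) z) = wl (wswap (wl w x) (wl w y)) (wl w z).
Proof.
rewrite [RHS]wl_swap !wl_fst wl_swap; case: z => k d /=.
case: eqP => [->|_]; last case: eqP => [->|_] //.
  by rewrite !wl_pairE /=; congr pair; case: x.2 y.2 d (w.2 _) (w.2 _) => [] [] [] [] [].
by rewrite !wl_pairE /=; congr pair; case: x.2 y.2 d (w.2 _) (w.2 _) => [] [] [] [] [].
Qed.

Lemma w_inv_eq w w' : (forall x, wl w (wl w' x) = x) -> w_inv w = w'.
Proof. by move=> ww'; apply/wn_ext => x; rewrite -{1}(ww' x) wlVK. Qed.

Lemma perm_extends (s t : seq 'I_n) :
  uniq s -> uniq t -> size s = size t -> exists p : {perm 'I_n}, map p s = t.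
Proof.
elim: s t => [|i s IH] [|j t] //=; first by exists 1.
move=> /andP[si us] /andP[tj ut] [/(IH _ us ut)[p pst]].
(* The transposition brings [p i] to [j]; neither of them occurs among the images already
   arranged. *)
exists (p * tperm (p i) j) => /=; rewrite permM tpermL; congr (_ :: _).
rewrite -pst; apply/eq_in_map => k ks; rewrite permM tpermD //.
  by rewrite (inj_eq perm_inj); apply: contraNneq si => ->.
by apply: contraNneq tj => ->; rewrite -pst map_f.
Qed.

Lemma wn_trans (s : seq 'I_n) (t : seq (letter n)) :
  uniq s -> uniq (map fst t) -> size s = size t ->
  exists w, [seq wl w (i, false) | i <- s] = t.
Proof.
move=> us ut st; have [|p pst] := perm_extends us ut; first by rewrite size_map.
exists (p, [ffun i => nth false (map snd t) (index i s)]).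
elim: s t us pst {st ut} => [|i s IH] [|[j b] t] //= /andP[si us] [pij pst].
rewrite {1}wl_pairE /= ffunE eqxx /= addbF pij; congr (_ :: _).
rewrite -[RHS](IH _ us pst); apply/eq_in_map => k ks.
by rewrite !wl_pairE /= !ffunE; case: eqP => // ik; rewrite ik ks in si.
Qed.

Lemma fresh_index (s : seq 'I_n) : size s < n -> exists i, i \notin s.
Proof.
move=> sn; case: (pickP [pred i | i \notin s]) => [i|all_s]; first by exists i.
have: #|'I_n| <= size s.
  apply: leq_trans (card_size s); apply/subset_leq_card/subsetP => i _.
  exact: negbFE (all_s i).
by rewrite card_ord leqNgt sn.
Qed.

End SignedPerm.

(** Relations in the style of Gersten, stated for all letters at once, with [stS] tying the
    transvections to the quarter turns. *)
Record steinberg (n : nat) (G : groupType) (iW : wn n -> G)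
    (E : letter n -> letter n -> G) : Prop := Steinberg {
  stW1 : iW (wone n) = 1;
  stWM : forall w1 w2, iW (wmul w1 w2) = iW w1 * iW w2;
  stW_E : forall w x y, x.1 != y.1 -> iW w * E x y = E (wl w x) (wl w y) * iW w;
  stV : forall x y, x.1 != y.1 -> E x y^! = (E x y)^-1;
  stC : forall x y z t, x.1 != y.1 -> z.1 != t.1 -> x != z ->
    x.1 != t.1 -> z.1 != y.1 -> commute (E x y) (E z t);
  stR : forall a b c, uniq [:: a.1; b.1; c.1] -> E b c ^ E a b = E b c * E a c;
  stS : forall a b, a.1 != b.1 -> E b^! a * E a b * E b a^! = iW (wswap a b) }.

Record steinberg_action (n : nat) (G : groupType) (iW : wn n -> G)
    (E : letter n -> letter n -> G) (act : G -> fgroup n -> fgroup n) : Prop := SteinbergAction {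
  sa_actM : forall g h u, act (g * h) u = act g (act h u);
  sa_act1 : forall u, act 1 u = u;
  sa_morph : forall g, {morph act g : u v / u * v};
  sa_W : forall w x, act (iW w) (fgen x) = fgen (wl w x);
  sa_E : forall x y, x.1 != y.1 -> act (E x y) (fgen x) = fgen x * fgen y;
  sa_E_out : forall x y z, x.1 != y.1 -> z.1 != x.1 -> act (E x y) (fgen z) = fgen z }.

(** * From the relators to the Steinberg relations *)

Section Model.
Variables (n : nat) (hn : 3 < n) (G : groupType) (iW : wn n -> G) (e : G).

Let I1 := i1 hn. Let I2 := i2 hn. Let I3 := i3 hn. Let I4 := i4 hn.
Let s12 := iW (sigma I1 I2).
Let s13 := iW (sigma I1 I3).
Let s14 := iW (sigma I1 I4).
Let s23 := iW (sigma I2 I3).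
Let t1 := iW (tau I1).
Let t2 := iW (tau I2).

Hypothesis iWP : forall ws : seq (wn n),
  (forall x, foldr (@wl n) x ws = x) -> \prod_(w <- ws) iW w = 1.
Hypothesis r1 : e * e = 1.
Hypothesis r2 : (s12 * e) ^+ 3 = 1.
Hypothesis r3 : forall i : 'I_n, 1 < i -> (e * iW (tau i)) ^+ 2 = 1.
Hypothesis r4 : forall i j : 'I_n, 1 < i -> 1 < j -> i != j ->
  (e * iW (sigma i j)) ^+ 2 = 1.
Hypothesis r5 : ((e * t1) ^+ 2 * t2) ^+ 2 = 1.
Hypothesis r7 : s12 * e * s13 * t2 * e * s12 * (s23 * e * s13 * t2 * e) ^+ 2 = 1.
Hypothesis r8 : (s14 * s23 * e) ^+ 4 = 1.

Implicit Types (w : wn n) (i j : 'I_n) (x y z t a b c : letter n).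

Lemma model_iW1 : iW (wone n) = 1.
Proof. by have := @iWP [:: wone n]; rewrite big_seq1; apply=> x /=; rewrite wl1. Qed.

Lemma model_iWV w : iW (w_inv w) = (iW w)^-1.
Proof.
apply/esym/mulg1_eq; have := @iWP [:: w; w_inv w].
by rewrite big_cons big_seq1; apply=> x /=; rewrite wlV.
Qed.

Lemma model_iWM w1 w2 : iW (wmul w1 w2) = iW w1 * iW w2.
Proof.
apply/eqP; rewrite eq_sym -divg_eq1 -model_iWV -mulgA; apply/eqP.
have := @iWP [:: w1; w2; w_inv (wmul w1 w2)].
by rewrite !big_cons big_nil mulg1; apply=> x /=; rewrite -wlM wlV.
Qed.

Lemma mulg_self_commute (H : groupType) (u v : H) :
  u * u = 1 -> v * v = 1 -> (u * v) ^+ 2 = 1 -> commute u v.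
Proof.
move=> uu vv; rewrite expg2 /commute => uvuv; apply: (mulIg (u * v)).
by rewrite /= uvuv -mulgA (mulgA u u) uu mul1g vv.
Qed.

Lemma iW_tau2 i : iW (tau i) * iW (tau i) = 1.
Proof.
rewrite -model_iWM -model_iW1; congr iW; apply/wn_ext => x.
by rewrite wlM !wl_tau wl1 /= addbA addbb; case: x.
Qed.

Lemma iW_sigma2 i j : iW (sigma i j) * iW (sigma i j) = 1.
Proof.
rewrite -model_iWM -model_iW1; congr iW; apply/wn_ext => x.
rewrite wlM wl1 !wl_pairE /= !ffunE tpermK.
by case: x.
Qed.

Lemma index_gt1 i : i != I1 -> i != I2 -> 1 < i.
Proof. by case: i => -[|[|m]]. Qed.

Let wcent w := commute e (iW w).

Lemma wcentM w1 w2 : wcent w1 -> wcent w2 -> wcent (wmul w1 w2).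
Proof. by rewrite /wcent model_iWM; apply: commuteM. Qed.

Lemma wcent1 : wcent (wone n).
Proof. by rewrite /wcent model_iW1; apply: commute1. Qed.

(** Induction on the number of moved points: the transposition of [i] and [s i], which commutes with
    [e] by [r4], brings [i] to rest and disturbs no fixed point. *)
Lemma wcent_perm (s : {perm 'I_n}) : s I1 = I1 -> s I2 = I2 -> wcent (s, [ffun=> false]).
Proof.
have [m] := ubnP #|[set i | s i != i]|; elim: m s => // m IH s ms s1 s2.
case: (pickP [pred i | s i != i]) => [i si | s_id]; last first.
  suff ->: s = 1 by apply: wcent1.
  by apply/permP => i; rewrite perm1; have /negbFE/eqP := s_id i.
have iP : 1 < i by apply: index_gt1; apply: contraNneq si => ->; rewrite /= (s1, s2).
have siP : 1 < s i.
  apply: index_gt1; [rewrite -[X in _ != X]s1 | rewrite -[X in _ != X]s2];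
    by rewrite (inj_eq perm_inj); apply: contraNneq si => ->; rewrite /= (s1, s2).
have fixed j : s j = j -> (s * tperm i (s i)) j = j.
  move=> sj; rewrite permM sj tpermD //.
    by apply: contraNneq si => ->; rewrite /= sj.
  by apply: contraNneq si => si_j; rewrite /= (perm_inj (etrans si_j (esym sj))) sj.
have -> : (s, [ffun=> false]) =
    wmul (sigma i (s i)) ((s * tperm i (s i)), [ffun=> false]).
  apply/wn_ext => x; rewrite wlM !wl_pairE /= permM tpermK !ffunE.
  by case: x.
apply: wcentM.
  apply: mulg_self_commute r1 (iW_sigma2 _ _) _.
  by apply: r4 => //; rewrite eq_sym.
apply: IH; rewrite ?fixed //; rewrite ltnS in ms; apply: leq_trans ms.
apply: proper_card; apply/properP; split.
  apply/subsetP => j; rewrite !inE; apply: contra => /eqP sj; exact/eqP/fixed.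
by exists i; rewrite !inE // permM tpermR eqxx.
Qed.

Lemma wcent_sign (d : {ffun 'I_n -> bool}) : d I1 = false -> d I2 = false -> wcent (1, d).
Proof.
have [m] := ubnP #|[set i | d i]|; elim: m d => // m IH d md d1 d2.
case: (pickP d) => [i di | d0]; last first.
  suff -> : d = [ffun=> false] by apply: wcent1.
  by apply/ffunP => i; rewrite ffunE d0.
have iP : 1 < i by apply: index_gt1; apply: contraTneq di => ->; rewrite (d1, d2).
have -> : (1, d) = wmul (tau i) (1, [ffun j => (j != i) && d j]).
  apply/wn_ext => x; rewrite wlM wl_tau !wl_pairE /= !ffunE perm1.
  by case: eqP => [->|]; rewrite ?di.
apply: wcentM; first exact: mulg_self_commute r1 (iW_tau2 _) (r3 iP).
apply: IH; rewrite ?ffunE ?d1 ?d2 ?andbF //; rewrite ltnS in md.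
apply: leq_trans md; apply: proper_card; apply/properP; split.
  by apply/subsetP => j; rewrite !inE ffunE => /andP[].
by exists i; rewrite !inE // ffunE eqxx.
Qed.

Let A1 : letter n := (I1, false).
Let A2 : letter n := (I2, false).
Let A3 : letter n := (I3, false).
Let A4 : letter n := (I4, false).

Lemma wcent_fix w : wl w A1 = A1 -> wl w A2 = A2 -> wcent w.
Proof.
case: w => s d; rewrite !wl_pairE !addbF => -[s1 d1] [s2 d2].
have -> : (s, d) = wmul (s, [ffun=> false]) (1, d).
  by apply/wn_ext => x; rewrite wlM !wl_pairE /= !ffunE perm1.
by apply: wcentM; [apply: wcent_perm | apply: wcent_sign].
Qed.

Let b0 := e * t2.

(* [W_n] permutes the conjugates of [b0] as it permutes pairs of letters. *)
Lemma b0_fix w : wl w A1^! = A1^! -> wl w A2 = A2 -> commute b0 (iW w).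
Proof.
rewrite wl_inv => /inv_letter_inj wA1 wA2.
apply: commute_sym; apply: commuteM; apply: commute_sym; first exact: wcent_fix.
rewrite /commute -!model_iWM; congr iW; apply/wn_ext => x; rewrite !wlM !wl_tau /=.
case: x => k d /=; rewrite !wl_pairE /=.
have -> : (w.1 k == I2) = (k == I2).
  have w2 : w.1 I2 = I2 by move: wA2; rewrite wl_pairE => -[].
  by rewrite -{1}w2 (inj_eq perm_inj).
by rewrite addbCA.
Qed.

(* [transv x y] acts as [x |-> x y]; the generator [eta] is [transv a_1^-1 a_2] times [tau_2]. *)
Definition transv x y : G :=
  if [pick w | (wl w A1^! == x) && (wl w A2 == y)] is Some w
  then iW w * b0 * (iW w)^-1 else 1.

(** The choice made by [pick] does not matter: two candidates differ by an element fixing [A1^!] and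
    [A2], which commutes with [b0]. *)
Lemma transv_wlE w : transv (wl w A1^!) (wl w A2) = iW w * b0 * (iW w)^-1.
Proof.
rewrite /transv; case: pickP => [w' /andP[/eqP w'1 /eqP w'2] | /(_ w)]; last by rewrite !eqxx.
have := @b0_fix (wmul (w_inv w) w'); rewrite !wlM w'1 w'2 !wlVK => /(_ erefl erefl).
rewrite model_iWM model_iWV /commute => H; apply: (mulIg (iW w')); rewrite mulgVK.
rewrite -(mulgA _ (iW w)^-1) -(mulgA (iW w)) H.
by rewrite !mulgA mulgV mul1g.
Qed.

Lemma wn_trans4 x y z t : uniq [:: x.1; y.1; z.1; t.1] ->
  exists w, [/\ wl w A1^! = x, wl w A2 = y, wl w A3 = z & wl w A4 = t].
Proof.
move=> xyzt; have [|||w eqs] := @wn_trans _ [:: I1; I2; I3; I4] [:: x^!; y; z; t] => //.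
exists w; split.
- by have /= := congr1 (nth x ^~ 0) eqs; rewrite wl_inv => ->; rewrite inv_letterK.
- by have /= := congr1 (nth x ^~ 1%N) eqs.
- by have /= := congr1 (nth x ^~ 2) eqs.
- by have /= := congr1 (nth x ^~ 3) eqs.
Qed.

Lemma wn_trans3 x y z : uniq [:: x.1; y.1; z.1] ->
  exists w, [/\ wl w A1^! = x, wl w A2 = y & wl w A3 = z].
Proof.
move=> xyz; have [//|i ixyz] := @fresh_index n [:: x.1; y.1; z.1].
have [|w [w1 w2 w3 _]] := @wn_trans4 x y z (i, false); last by exists w.
by rewrite -[_ :: _]/(rcons [:: x.1; y.1; z.1] i) rcons_uniq ixyz.
Qed.

Lemma wn_trans2 x y : x.1 != y.1 -> exists w, wl w A1^! = x /\ wl w A2 = y.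
Proof.
move=> xy; have [|i ixy] := @fresh_index n [:: x.1; y.1]; first exact: ltnW.
have [|w [w1 w2 _]] := @wn_trans3 x y (i, false); last by exists w.
by rewrite -[_ :: _]/(rcons [:: x.1; y.1] i) rcons_uniq ixy /= inE xy.
Qed.

Lemma iW_transv w x y : x.1 != y.1 -> iW w * transv x y = transv (wl w x) (wl w y) * iW w.
Proof.
case/wn_trans2=> v [<- <-].
rewrite -!wlM !transv_wlE !model_iWM invgM.
by rewrite !mulgA mulgVK.
Qed.

Lemma iW_transvA w x y g : x.1 != y.1 ->
  iW w * (transv x y * g) = transv (wl w x) (wl w y) * (iW w * g).
Proof. by move=> xy; rewrite mulgA iW_transv // -mulgA. Qed.

Lemma iWMA w1 w2 g : iW w1 * (iW w2 * g) = iW (wmul w1 w2) * g.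
Proof. by rewrite model_iWM mulgA. Qed.

Lemma eta_transv : e = transv A1^! A2 * iW (tau I2).
Proof.
have := transv_wlE (wone n); rewrite !wl1 model_iW1 mul1g invg1 mulg1 => ->.
by rewrite -mulgA iW_tau2 mulg1.
Qed.

Lemma distinct_index : ((I1 == I2) = false) * ((I1 == I3) = false) * ((I1 == I4) = false)
  * ((I2 == I1) = false) * ((I2 == I3) = false) * ((I2 == I4) = false)
  * ((I3 == I1) = false) * ((I3 == I2) = false) * ((I3 == I4) = false)
  * ((I4 == I1) = false) * ((I4 == I2) = false) * ((I4 == I3) = false).
Proof. by []. Qed.

Lemma transvV x y : x.1 != y.1 -> transv x y^! = (transv x y)^-1.
Proof.
case/wn_trans2=> v [<- <-].
rewrite transv_wlE.
have -> : (wl v A2)^! = wl (wmul v (tau I2)) A2 by rewrite wlM wl_tau -wl_inv.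
have -> : wl v A1^! = wl (wmul v (tau I2)) A1^! by rewrite wlM wl_tau.
have eV : e^-1 = e by apply: mulg1_eq.
have tV : t2^-1 = t2 by apply/mulg1_eq/iW_tau2.
by rewrite transv_wlE /b0 model_iWM -/t2 !invgM invgK eV tV !mulgA -(mulgA _ t2 t2) iW_tau2 mulg1.
Qed.

Let pair_sigma i j k d :
  wl (sigma i j) (k, d) = (if k == i then j else if k == j then i else k, d).
Proof. exact: wl_sigma. Qed.

Let pair_tau i k d : wl (tau i) (k, d) = (k, (k == i) (+) d).
Proof. exact: wl_tau. Qed.

Let pair_swap x y k d : wl (wswap x y) (k, d) =
  if k == x.1 then (y.1, x.2 (+) y.2 (+) d)
  else if k == y.1 then (x.1, ~~ (x.2 (+) y.2 (+) d)) else (k, d).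
Proof. exact: wl_swap. Qed.

Ltac pair_calc := rewrite !wlM /A1 /A2 /A3 /A4 /inv_letter /=;
  do 30?[progress rewrite ?(pair_sigma, pair_tau, pair_swap) /= ?(eqxx, distinct_index) /=].

Ltac letter_cases :=
  let k := fresh "k" in let d := fresh "d" in
  let h1 := fresh in let h2 := fresh in let h3 := fresh in let h4 := fresh in
  move=> [k d]; rewrite !wlM;
  case: (eqVneq k I1) => [->|/negPf h1]; last
  case: (eqVneq k I2) => [->|/negPf h2]; last
  case: (eqVneq k I3) => [->|/negPf h3]; last
  case: (eqVneq k I4) => [->|/negPf h4];
  do 30?[progress rewrite ?(pair_sigma, pair_tau, pair_swap) /=
        ?(eqxx, distinct_index) /=
        ?(h1, h2, h3, h4) /= ];
  case: d => //.

(** Replacing [e] by [eta_transv] and moving the signed permutations of [r2] to the right leaves a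
    product of transvections equal to one signed permutation, identified letter by letter. The
    relators [r5], [r7] and [r8] are treated in the same way below. *)
Lemma transv_swap_base : transv A2^! A1 * transv A1 A2 * transv A2 A1^! = iW (wswap A1 A2).
Proof.
have := r2; rewrite !expgS expg0 mulg1 /s12 eta_transv -!mulgA.
rewrite !(iW_transvA, iWMA) ?wl_fst // -?model_iWM !mulgA => /eqP.
rewrite mulg_eq1 -model_iWV; pair_calc => /eqP H.
apply: etrans H _.
congr iW; apply: w_inv_eq.
by letter_cases.
Qed.

Lemma transv_swap a b : a.1 != b.1 ->
  transv b^! a * transv a b * transv b a^! = iW (wswap a b).
Proof.
case/(@wn_trans2 a^! b) => w [wA1 <-].
have <- : wl w A1 = a by apply: inv_letter_inj; rewrite -wl_inv.
apply: (mulIg (iW w)) => /=; rewrite -!mulgA -!wl_inv.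
rewrite -!(iW_transv, iW_transvA) // [transv A2^! A1 * _]mulgA transv_swap_base -!model_iWM.
congr iW.
by apply/wn_ext => x; rewrite !wlM wl_swapJ.
Qed.

(** [r7] gives the quarter turn of [transv_swap_base] with three more transvections, all of source
    [A3^!]. Equating the two expressions and cancelling the common outer factors leaves the
    relation. *)
Lemma transv_conj_base :
  transv A1 A2 * transv A3^! A2 = transv A3^! A1^! * transv A1 A2 * transv A3^! A1.
Proof.
have := r7; rewrite expg2 /s12 /s23 /s13 eta_transv -!mulgA.
rewrite !(iW_transvA, iWMA) ?wl_fst // -?model_iWM !mulgA => /eqP.
rewrite mulg_eq1 -model_iWV; pair_calc => /eqP H.
have {}H : transv A2^! A1 * transv A3^! A1 * transv A1 A2 * transv A3^! A2 * transv A3^! A1^! *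
    transv A2 A1^! =
   iW (wswap A1 A2).
  apply: etrans H _.
  congr iW; apply: w_inv_eq.
  by letter_cases.
move: H; rewrite -transv_swap // => /mulIg; rewrite -!mulgA => /mulgI H.
move: H; rewrite [transv A3^! A1^!]transvV // => H.
apply: (mulIg (transv A3^! A1)^-1); apply: (mulgI (transv A3^! A1)) => /=.
by rewrite -mulgA H !mulgA mulgV mul1g mulgK.
Qed.

Lemma transv_conj a b c : uniq [:: a.1; b.1; c.1] ->
  transv b c ^ transv a b = transv b c * transv a c.
Proof.
move=> abc; have [|w [w1 w2 w3]] := @wn_trans3 b^! c a^!.
  move: abc; rewrite /= !inE !negb_or [c.1 == a.1]eq_sym [b.1 == a.1]eq_sym.
  by case/and3P=> /andP[-> ->] ->.
have {w1} wb : wl w A1 = b by apply: inv_letter_inj; rewrite -wl_inv.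
have {w3} wa : wl w A3^! = a by rewrite wl_inv w3 inv_letterK.
rewrite /conjg; apply: (mulIg (iW w)) => /=; rewrite -transvV; last first.
  by case/andP: abc; rewrite inE negb_or => /andP[].
rewrite -wa -wb -w2 -!mulgA -!wl_inv -!(iW_transv, iW_transvA) //.
by rewrite transv_conj_base !mulgA.
Qed.

(* Compare [transv_conj] for [c] and for its inverse. *)
Lemma transv_commute_source a b c : uniq [:: a.1; b.1; c.1] -> commute (transv b c) (transv a c).
Proof.
move=> abc; have H := transv_conj abc; have := @transv_conj a b c^! abc.
have [ac bc] : a.1 != c.1 /\ b.1 != c.1.
  by move: abc; rewrite /= !inE negb_or => /and3P[/andP[]].
rewrite (transvV bc) (transvV ac) conjVg H -invgM => /invg_inj.
by [].
Qed.

(** Once normalised, [r5] is the commutator of [transv A1^! A2] and the inverse of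
    [transv A1 A2]. *)
Lemma transv_commute_inv_base : commute (transv A1^! A2) (transv A1 A2^!).
Proof.
have := r5; rewrite !expg2 /t1 /t2 eta_transv -!mulgA.
rewrite !(iW_transvA, iWMA) ?wl_fst // -?model_iWM !mulgA => /eqP.
rewrite mulg_eq1 -model_iWV; pair_calc => /eqP H.
have {H} : transv A1^! A2 * transv A1 A2^! * transv A1^! A2^! * transv A1 A2 = iW (wone n).
  apply: etrans H _.
  congr iW; apply: w_inv_eq => x; rewrite wl1; move: x.
  by letter_cases.
rewrite model_iW1 (@transvV A1^! A2) // (@transvV A1 A2) // => H.
apply/invg_inj/mulg1_eq; rewrite !invgM !invgK !mulgA.
exact: H.
Qed.

Lemma transv_wl w x y : x.1 != y.1 -> transv (wl w x) (wl w y) = transv x y ^ (iW w)^-1.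
Proof.
by move=> xy; apply: (mulIg (iW w)); rewrite /= -iW_transv // /conjg invgK -!mulgA mulVg mulg1.
Qed.

Lemma commute_wl w x y z t : x.1 != y.1 -> z.1 != t.1 ->
  commute (transv x y) (transv z t) ->
  commute (transv (wl w x) (wl w y)) (transv (wl w z) (wl w t)).
Proof. by move=> xy zt C; rewrite !transv_wl // /commute -!conjMg C. Qed.

Lemma commuteVr (H : groupType) (u v : H) : commute u v^-1 -> commute u v.
Proof. by move=> /commuteV; rewrite invgK. Qed.

Lemma transv_commute_inv a b : a.1 != b.1 -> commute (transv a b) (transv a^! b).
Proof.
move=> ab; apply/commuteVr; rewrite -transvV //.
have [w [<- <-]] := wn_trans2 ab.
by rewrite -!wl_inv inv_letterK; apply: commute_wl => //; apply: transv_commute_inv_base.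
Qed.

(* [transv_swap] writes [transv a b] as a product of elements whose conjugation action on
   [transv a^! c] is known from [transv_conj]. *)
Lemma transv_commute_opp a b c : uniq [:: a.1; b.1; c.1] -> commute (transv a b) (transv a^! c).
Proof.
move=> abc; have /and4P[ab ac bc _] : [&& a.1 != b.1, a.1 != c.1, b.1 != c.1 & true].
  by move: abc; rewrite /= !inE negb_or => /and3P[/andP[-> ->] ->].
have ba : b.1 != a.1 by rewrite eq_sym.
have Eab : transv a b = transv b^! a^! * iW (wswap a b) * transv b a.
  by rewrite -transv_swap // !transvV // !mulgA mulVg mul1g mulgVK.
have Q1 : transv b a * transv a^! c = transv a^! c * transv b c * transv b a.
  have := @transv_conj b a^! c; rewrite /= !inE !negb_or ba bc ac => /(_ isT) <-.
  by rewrite /conjg transvV // invgK !mulgA mulgVK.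
have Q2 : iW (wswap a b) * (transv a^! c * transv b c) =
    transv b^! c * transv a^! c * iW (wswap a b).
  have ca : c.1 != a.1 by rewrite eq_sym.
  have cb : c.1 != b.1 by rewrite eq_sym.
  by rewrite iW_transvA // iW_transv // !wl_inv wl_swapl wl_swapr // wl_swap_out // mulgA.
have Q3 : transv b^! a^! * (transv b^! c * transv a^! c) = transv a^! c * transv b^! a^!.
  rewrite (transv_commute_source (b := b^!) (a := a^!)); last first.
    by rewrite /= !inE !negb_or ab ac bc.
  have := @transv_conj b^! a^! c; rewrite /= !inE !negb_or ba bc ac => /(_ isT) <-.
  by rewrite /conjg mulVKg.
rewrite /commute Eab -[LHS]mulgA Q1 [LHS]mulgA -[transv b^! a^! * _ * (transv a^! c * _)]mulgA.
by rewrite Q2 !mulgA -(mulgA (transv b^! a^!)) Q3 ?mulgA.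
Qed.

Lemma transv_commute_far_base : commute (transv A1^! A2) (transv A4^! A3).
Proof.
have := r8; rewrite !expgS expg0 mulg1 /s14 /s23 eta_transv -!mulgA.
rewrite !(iW_transvA, iWMA) ?wl_fst // -?model_iWM !mulgA => /eqP.
rewrite mulg_eq1 -model_iWV; pair_calc => /eqP H.
have {H} : transv A4^! A3 * transv A1^! A2 * transv A4^! A3^! * transv A1^! A2^! = iW (wone n).
  apply: etrans H _.
  congr iW; apply: w_inv_eq => x; rewrite wl1; move: x.
  by letter_cases.
rewrite model_iW1 (@transvV A1^! A2) // (@transvV A4^! A3) // => H.
apply/esym/invg_inj/mulg1_eq; rewrite !invgM !mulgA.
exact: H.
Qed.

Lemma transv_commute_far a b c d : uniq [:: a.1; b.1; c.1; d.1] ->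
  commute (transv a b) (transv c d).
Proof.
move=> abcd; have [|w [<- <- <- w4]] := @wn_trans4 a b d c^!.
  move: abcd; rewrite /= !inE !negb_or [d.1 == c.1]eq_sym.
  by do ![case: (_ == _)].
have <- : wl w A4^! = c by rewrite wl_inv w4 inv_letterK.
by apply: commute_wl => //; apply: transv_commute_far_base.
Qed.

(** The cases depend on whether the sources or the multipliers share an index. Since [x != z],
    sources of the same index are mutually inverse. *)
Lemma transv_commute x y z t : x.1 != y.1 -> z.1 != t.1 -> x != z -> x.1 != t.1 -> z.1 != y.1 ->
  commute (transv x y) (transv z t).
Proof.
move=> xy zt xz xt zy.
have zx := eqVneq z.1 x.1; have yt := eqVneq y.1 t.1.
case: zx => [/same_index[zx|->]|zx]; first by rewrite zx eqxx in xz.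
  case: yt => [/esym/same_index[->|->]|yt]; first exact: transv_commute_inv.
    by rewrite transvV //; apply/commuteV/transv_commute_inv.
  by apply: transv_commute_opp; rewrite /= !inE negb_or xy xt yt.
have xz1 : x.1 != z.1 by rewrite eq_sym.
have yz1 : y.1 != z.1 by rewrite eq_sym.
case: yt => [/esym/same_index[->|->]|yt].
- by apply: transv_commute_source; rewrite /= !inE negb_or zx zy xy.
- rewrite transvV //; apply: commuteV.
  by apply: transv_commute_source; rewrite /= !inE negb_or zx zy xy.
by apply: transv_commute_far; rewrite /= !inE !negb_or xy xz1 xt yz1 yt zt.
Qed.

Lemma model_steinberg : steinberg iW transv.
Proof.
split; [exact: model_iW1 | exact: model_iWM | exact: iW_transv | exact: transvV
  | exact: transv_commute | exact: transv_conj | exact: transv_swap].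
Qed.

Variable act : G -> fgroup n -> fgroup n.
Hypothesis actM : forall g h u, act (g * h) u = act g (act h u).
Hypothesis act1 : forall u, act 1 u = u.
Hypothesis actm : forall g, {morph act g : u v / u * v}.
Hypothesis act_W : forall w x, act (iW w) (fgen x) = fgen (wl w x).
Hypothesis act_e1 : act e (fgen A1) = (fgen A2)^-1 * fgen A1.
Hypothesis act_e2 : act e (fgen A2) = (fgen A2)^-1.
Hypothesis act_e : forall x, x.1 != I1 -> x.1 != I2 -> act e (fgen x) = fgen x.

Lemma model_action : steinberg_action iW transv act.
Proof.
have actV g : {morph act g : u / u^-1} by apply/morphV_group/actm.
have t0 : transv A1^! A2 = e * t2.
  by have := transv_wlE (wone n); rewrite !wl1 model_iW1 mul1g invg1 mulg1.
have t0_1 : act (transv A1^! A2) (fgen A1^!) = fgen A1^! * fgen A2.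
  by rewrite t0 actM act_W wl_tau -[X in fgen X]/(A1^!) fgenV actV act_e1 invgM invgK.
have e2 (s : bool) : act e (fgen (I2, s)) = fgen (I2, ~~ s).
  have A2V : fgen (I2, true) = (fgen A2)^-1 by rewrite -fgenV.
  by case: s; rewrite ?A2V ?actV -/A2 act_e2 ?invgK.
have t0_out z : z.1 != I1 -> act (transv A1^! A2) (fgen z) = fgen z.
  move=> z1; rewrite t0 actM act_W wl_tau.
  case: (eqVneq z.1 I2) => [z2|z2] /=; last by rewrite -surjective_pairing act_e.
  by rewrite z2 e2 negbK -z2 -surjective_pairing.
have transv_w w x y u : x.1 != y.1 ->
    act (transv (wl w x) (wl w y)) (act (iW w) u) = act (iW w) (act (transv x y) u).
  by move=> xy; rewrite -!actM iW_transv.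
split=> // [x y|x y z].
  case/wn_trans2=> w [<- <-]; have := @transv_w w A1^! A2 (fgen A1^!) isT.
  by rewrite act_W t0_1 => ->; rewrite actm !act_W.
case/wn_trans2=> w [<- <-]; rewrite -{1}(wlV w z) wl_fst => z1.
have := @transv_w w A1^! A2 (fgen (wl (w_inv w) z)) isT.
by rewrite t0_out // act_W wlV.
Qed.

End Model.

(** * Whitehead elements *)

Section CommutingProducts.
Variables (G : groupType) (I : eqType).

(** Commutation is asked only for distinct indices, because in [E_phi] the factors [E x a] and
    [E x b] with the same [x] need not commute. *)
Lemma prodgM_commute_neq (r : seq I) (P : pred I) (F H : I -> G) : uniq r ->
  (forall i j, P i -> P j -> i != j -> commute (H i) (F j)) ->
  \prod_(i <- r | P i) (F i * H i) =
    \prod_(i <- r | P i) F i * \prod_(i <- r | P i) H i.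
Proof.
move=> + HF; elim: r => [|i r IH] /=; rewrite !(big_nil, big_cons) ?mulg1 //.
case/andP=> ir /IH{}IH; case: ifPn => // Pi; rewrite IH !mulgA; congr (_ * _).
rewrite -!mulgA; congr (_ * _); rewrite big_seq_cond.
apply: commute_prod => j /andP[jr Pj]; apply: HF => //.
by apply: contraNneq ir => ->.
Qed.

Lemma perm_prod_commute (r1 r2 : seq I) (F : I -> G) : perm_eq r1 r2 ->
  {in r1 &, forall i j, commute (F i) (F j)} ->
  \prod_(i <- r1) F i = \prod_(i <- r2) F i.
Proof.
elim: r1 r2 => [|i r1 IH] r2 pr FF.
  by move: pr; rewrite perm_sym => /perm_nilP->.
have ir2 : i \in r2 by rewrite -(perm_mem pr) mem_head.
case/splitPr: r2 / ir2 pr => [r3 r4] pr.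
have pr1 : perm_eq r1 (r3 ++ r4).
  by rewrite -(perm_cons i) (perm_trans pr) // -cat1s perm_catCA.
rewrite big_cons (IH _ pr1) ?big_cat ?big_cons /=; last first.
  by move=> j k jr kr; apply: FF; rewrite inE (jr, kr) orbT.
rewrite !mulgA; congr (_ * _); rewrite big_seq.
apply: commute_prod => j jr; apply: FF; first exact: mem_head.
by rewrite inE (perm_mem pr1) mem_cat jr orbT.
Qed.

End CommutingProducts.

Section Whitehead.
Variables (n : nat) (G : groupType) (iW : wn n -> G) (E : letter n -> letter n -> G).
Implicit Types (w : wn n) (i j : 'I_n) (x y z t a b c d : letter n).
Implicit Types A B : pred (letter n).

Hypothesis St : steinberg iW E.
Let iW1 := stW1 St.
Let iWM := stWM St.
Let iW_E := stW_E St.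
Let S1 := stV St.
Let S2 := stC St.
Let S3 := stR St.
Let S4 := stS St.

(** The classical Whitehead automorphism of the pair [(A, a)]: a letter lying in [A] together with
    its inverse is conjugated by [a]. The factors commute, so their order is immaterial. *)
Definition phi a (A : pred (letter n)) : G := \prod_(x | A x && (x.1 != a.1)) E x a.

Lemma neq_index_letter x a : (x.1 != a.1) = (x != a) && (x != a^!).
Proof.
case: x a => [i b] [j c]; rewrite /inv_letter !xpair_eqE /=.
by case: eqP => //= _; case: b; case: c.
Qed.

Lemma commute_same x y a : x.1 != a.1 -> y.1 != a.1 -> commute (E x a) (E y a).
Proof. by move=> xa ya; case: (eqVneq x y) => [->|xy] //; apply: S2. Qed.

Lemma eq_phi a A B : (forall x, x.1 != a.1 -> A x = B x) -> phi a A = phi a B.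
Proof. by move=> AB; apply: eq_bigl => x; case: (boolP (x.1 != _)) => [/AB->|]; rewrite ?andbF. Qed.

Lemma phiU a A B : (forall x, x.1 != a.1 -> ~~ (A x && B x)) ->
  phi a (fun x => A x || B x) = phi a A * phi a B.
Proof.
move=> dAB; rewrite /phi !(big_mkcond (fun x => _ && _)) /= -prodgM_commute.
  apply: eq_bigr => x _; case: (boolP (x.1 != a.1)) => [/dAB|]; rewrite ?andbF ?mulg1 //=.
  by case: (A x); case: (B x); rewrite ?mulg1 ?mul1g.
move=> x y _ _; case: ifP => [/andP[_ xa]|_]; last exact/commute_sym/commute1.
by case: ifP => [/andP[_ ya]|_]; [apply: commute_same | apply: commute1].
Qed.

Lemma phi0 a A : (forall x, x.1 != a.1 -> ~~ A x) -> phi a A = 1.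
Proof.
move=> A0; rewrite /phi big_pred0 // => x.
by case: (boolP (x.1 != a.1)) => [/A0/negPf->|]; rewrite ?andbF.
Qed.

Lemma phi_pred1 a x : x.1 != a.1 -> phi a (pred1 x) = E x a.
Proof.
move=> xa; rewrite /phi (eq_bigl (pred1 x)) ?big_pred1_eq // => y /=.
by case: eqP => [->|].
Qed.

Lemma phiD1 a A x : x.1 != a.1 -> A x ->
  phi a A = E x a * phi a (fun y => A y && (y != x)).
Proof.
move=> xa Ax; rewrite -phi_pred1 // -phiU; last by move=> y _ /=; case: eqP; rewrite ?andbF.
by apply: eq_phi => y _ /=; case: eqP => [->|]; rewrite ?andbT.
Qed.

Lemma phiV a A : phi a^! A = (phi a A)^-1.
Proof.
apply/esym/invg_inj; rewrite invgK; apply/esym/mulg1_eq.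
rewrite /phi -prodgM_commute.
  by rewrite big1 // => x /andP[_ xa]; rewrite S1 // mulVg.
move=> x y /andP[_ xa] /andP[_ ya]; rewrite S1 //.
exact/commute_sym/commuteV/commute_same.
Qed.

Lemma commute_phi g a A : (forall x, A x -> x.1 != a.1 -> commute g (E x a)) ->
  commute g (phi a A).
Proof. by move=> gE; apply: commute_prod => x /andP[Ax xa]; apply: gE. Qed.

Lemma iW_phi w a A : iW w * phi a A = phi (wl w a) (A \o wl (w_inv w)) * iW w.
Proof.
have iWV : (iW w)^-1 = iW (w_inv w).
  apply: mulg1_eq; rewrite -iWM -iW1; congr iW; apply/wn_ext => x.
  by rewrite wlM wlV wl1.
apply: (mulIg (iW w)^-1); rewrite /= mulgK -[LHS]mulgA.
rewrite -{1}[iW w]invgK -/(conjg _ _) conjg_prod.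
rewrite (eq_bigr (fun x => E (wl w x) (wl w a))); last first.
  by move=> x /andP[_ xa]; rewrite /conjg invgK mulgA iW_E // mulgK.
rewrite -(big_filter _ (fun x => A x && _)) -(big_map (wl w) predT (fun y => E y (wl w a))).
rewrite /phi -[RHS]big_filter; apply: perm_prod_commute.
  apply: uniq_perm;
    rewrite ?filter_uniq ?map_inj_uniq ?index_enum_uniq ?filter_uniq ?index_enum_uniq //.
    exact: wl_inj.
  move=> y; rewrite mem_filter mem_index_enum andbT /=.
  rewrite -{1}(wlV w y) mem_map; last exact: wl_inj.
  by rewrite mem_filter mem_index_enum andbT -(wl_fst w) wlV.
by move=> _ _ /mapP[x + ->] /mapP[y + ->]; rewrite !mem_filter;
  move=> /andP[/andP[_ xa] _] /andP[/andP[_ ya] _]; apply: commute_same; rewrite wl_fst.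
Qed.

(** Conjugation by [E a b] turns each factor [E x a] into [E x a * E x b]; factors with different
    [x] commute, so the product splits. *)
Lemma E_phi a b A : a.1 != b.1 -> (forall x, A x -> (x.1 != a.1) && (x.1 != b.1)) ->
  E a b * phi a A = phi a A * phi b A * E a b.
Proof.
move=> ab dA; apply: (mulIg (E a b)^-1); rewrite /= mulgK -[LHS]mulgA.
rewrite -{1}[E a b]invgK -/(conjg _ _) /phi conjg_prod.
rewrite [X in _ * X](eq_bigl (fun x => A x && (x.1 != a.1))); last first.
  by move=> x; case Ax: (A x) => //=; have /andP[-> ->] := dA _ Ax.
rewrite -prodgM_commute_neq ?index_enum_uniq //; last first.
  move=> x y /andP[/dA/andP[xa xb] _] /andP[/dA/andP[ya yb] _] xy.
  by apply: S2 => //; rewrite eq_sym.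
apply: eq_bigr => x /andP[/dA/andP[xa xb] _].
have := @S3 x a b; rewrite /= !inE negb_or xa xb ab => /(_ isT).
rewrite /conjg invgK => /(canRL (mulKg _)) H.
apply: (mulIg (E a b)); rewrite /= -!mulgA mulVg mulg1.
have C : commute (E a b) (E x b) by apply: commute_same.
by rewrite -C [RHS]mulgA H invgK mulgA.
Qed.

Lemma E_phiV a b A : a.1 != b.1 -> (forall x, A x -> (x.1 != a.1) && (x.1 != b.1)) ->
  E a^! b * phi a A = phi b^! A * phi a A * E a^! b.
Proof.
move=> ab dA; have := @E_phi a^! b A ab dA; rewrite !phiV => H.
apply: (mulIg (phi a A)^-1); rewrite /= mulgK -[RHS]mulgA H.
by rewrite !mulgA mulgK mulVg mul1g.
Qed.

(** Heuristically, [phi d A] conjugates [a] by [d] and multiplies [x] by [d], hence multiplies [x a]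
    by [d] as well. Formally, conjugation by [E x a] gives the factor at [a] an extra [E x d], and
    the one at [a^!] the inverse of the conjugated [E x d]; together with the factor at [x] these
    changes cancel. *)
Lemma commute_phi_E d A x a : x.1 != d.1 -> a.1 != d.1 -> x.1 != a.1 ->
  A x -> A a -> A a^! -> commute (phi d A) (E x a).
Proof.
move=> xd ad xa Ax Aa Aa'.
have ax : a != x by apply: contraNneq xa => ->.
have a'x : a^! != x by apply: contraNneq xa => <-.
rewrite (phiD1 ad Aa) (@phiD1 d _ x xd) ?Ax 1?eq_sym //.
rewrite (@phiD1 _ _ a^!) ?Aa' ?inv_letter_neq ?a'x //.
set B := fun y => _; rewrite 2!mulgA; apply/commute_sym/commuteM; last first.
  apply: commute_phi => y /andP[/andP[/andP[_ ya] yx] ya'] yd.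
  by apply: S2 => //; rewrite ?neq_index_letter ?ya // eq_sym.
have /= H1 := @S3 x a d; have /= H2 := @S3 x a^! d.
rewrite !inE !negb_or xa xd ad in H1 H2; have {H1 H2}[H1 H2] := (H1 isT, H2 isT).
have H3 : E a^! d ^ E x a = E a^! d * (E x d ^ E x a)^-1.
  apply: (mulIg (E x d ^ E x a)); rewrite /= mulgVK -conjMg -H2 S1 //.
  by rewrite -conjgM mulVg conjg1.
have H4 : E x d ^ E x a * (E a^! d * (E x d ^ E x a)^-1) = E a^! d.
  have C : commute (E x d) (E a^! d) by apply: commute_same.
  by rewrite -H3 -conjMg C conjMg H3 mulgVK.
suff: (E a d * E x d * E a^! d) ^ E x a = E a d * E x d * E a^! d.
  by move=> H; rewrite /commute -{1}H /conjg mulVKg.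
by rewrite !conjMg H1 H3 -[LHS]mulgA H4.
Qed.

(** The quarter turn of [a^!] and [d] is expanded by [stS] in two of its rotations, and it carries
    [E a^! d^!] to [E d a^!]. *)
Lemma E_rank2 a d : a.1 != d.1 ->
  E d a^! * E d^! a^! * E a^! d = E a d^! * E d a^! * E d^! a^!.
Proof.
move=> ad; have da : d.1 != a.1 by rewrite eq_sym.
have /= H1 := @S4 a^! d ad; have /= H2 := @S4 d^! a^! da.
rewrite !inv_letterK in H1 H2.
have ->: E a d^! * E d a^! * E d^! a^! = E a d^! * E d^! a^! * E d a^!.
  by rewrite -[LHS]mulgA (commute_same (x := d) (y := d^!)) // mulgA.
have C := iW_E (wswap a^! d) (x := a^!) (y := d^!) ad.
rewrite wl_swapl [wl _ d^!]wl_inv wl_swapr // !inv_letterK in C.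
rewrite -wswap_rot // in H2.
have -> : E a d^! * E d^! a^! = iW (wswap a^! d) * E a^! d^!.
  by rewrite -H2 (@S1 a^! d) // mulgK.
rewrite C -!mulgA; congr (_ * _).
have -> : E d a^! = (E d a)^-1 by apply: S1.
by rewrite -H1 mulgK.
Qed.

(** [A] is split into the pair [d], [d^!], handled by [E_rank2], and the remaining letters, handled
    by [E_phiV]. *)
Lemma phi_E a d A : a.1 != d.1 -> A d -> A d^! -> (forall x, A x -> x.1 != a.1) ->
  phi a^! A * E a^! d = E a d^! * phi d^! A * phi a^! A.
Proof.
move=> ad Ad Ad' Aa; have da : d.1 != a.1 by rewrite eq_sym.
pose A0 x := A x && (x.1 != d.1).
have phiA : phi a^! A = phi a^! A0 * (E d a^! * E d^! a^!).
  rewrite (@phiD1 a^! _ d) // (@phiD1 a^! _ d^!) ?Ad' ?inv_letter_neq //.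
  rewrite mulgA commute_phi; last first.
    move=> x _ xa; apply/commute_sym; apply: commuteM; exact: commute_same.
  congr (_ * _); apply: eq_phi => x _.
  by rewrite /A0 neq_index_letter -andbA.
have dA0 x : A0 x -> (x.1 != a.1) && (x.1 != d.1) by case/andP=> /Aa ->.
have H := @E_phiV a^! d^! A0 ad dA0; rewrite !inv_letterK in H.
have H1 : phi a^! A0 * E a d^! = E a d^! * phi d^! A0 * phi a^! A0.
  rewrite [X in X * phi a^! _]commute_phi; last first.
    by move=> x _ xd; apply: commute_same.
  by rewrite -mulgA H !mulgA (@phiV d) mulVg mul1g.
transitivity (phi a^! A0 * E a d^! * (E d a^! * E d^! a^!)).
  by rewrite phiA -[LHS]mulgA E_rank2 // !mulgA.
rewrite H1 -[LHS]mulgA -phiA; congr (_ * _ * _).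
by apply: eq_phi => x xd; rewrite /A0 xd andbT.
Qed.

(* [None] stands for the base point. The Whitehead element of a cut [A] only multiplies the letters
   on the side away from the base point, so [A] with [a] and its complement with [a^!] agree. *)
Definition wh (A : pred (option (letter n))) a : G :=
  if A None then phi a^! (fun x => ~~ A (Some x)) else phi a (fun x => A (Some x)).

Implicit Types D : pred (option (letter n)).

Lemma eq_wh D1 D2 a : D1 =1 D2 -> wh D1 a = wh D2 a.
Proof.
by move=> D12; rewrite /wh D12; case: ifP => _; apply: eq_phi => x _; rewrite D12.
Qed.

Lemma wh_compl D a : wh (predC D) a^! = wh D a.
Proof.
rewrite /wh /= inv_letterK; case: (D None) => //=.
by apply: eq_phi => x _; rewrite negbK.
Qed.

(** The inverse of the Whitehead element of [D] and [a] has multiplier [a^!], which must lie inside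
    its cut; so [a] and [a^!] change sides. *)
Definition flip a D : pred (option (letter n)) :=
  fun o => if o == Some a then false else (o == Some a^!) || D o.

Lemma neq_of_index x a : x.1 != a.1 -> ((x == a) = false) * ((x == a^!) = false).
Proof. by rewrite neq_index_letter => /andP[/negPf-> /negPf->]. Qed.

Lemma someE x y : (Some x == Some y) = (x == y). Proof. by []. Qed.

Lemma wh_flip D a : wh (flip a D) a^! = (wh D a)^-1.
Proof.
have flipE x : x.1 != a.1 -> flip a D (Some x) = D (Some x).
  by move=> xa; rewrite /flip !someE !(@neq_of_index x a xa).
rewrite /wh; have -> : flip a D None = D None by [].
by case: (D None); rewrite -phiV; apply: eq_phi => x xa; rewrite flipE.
Qed.

(** For a fixed multiplier, disjoint unions of sets become products. The multiplier is put back into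
    the difference because a cut has to contain it. *)
Lemma wh_nested D1 D2 a : (forall o, D1 o -> D2 o) ->
  wh D2 a = wh (fun o => D2 o && (~~ D1 o || (o == Some a))) a * wh D1 a.
Proof.
move=> D12; rewrite /wh /= orbF; case D2n: (D2 None) => /=; last first.
  have -> : D1 None = false by apply: contraFF D2n; apply: D12.
  rewrite -phiU => [|x xa]; last first.
    by rewrite someE (@neq_of_index x a xa) orbF; case: (D1 _); rewrite ?andbF.
  apply: eq_phi => x xa; rewrite someE (@neq_of_index x a xa) orbF.
  by have := D12 (Some x); case: (D1 _) => [->|]; rewrite ?andbT ?orbF.
case: (D1 None) => /=.
  have -> : phi a^! (fun x => ~~ D1 (Some x)) =
      phi a^! (fun x => (D2 (Some x) && (~~ D1 (Some x) || (Some x == Some a))) || ~~ D2 (Some x)).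
    apply: eq_phi => x xa; rewrite someE (@neq_of_index x a xa) orbF.
    by have := D12 (Some x); case: (D1 _) => [->|]; rewrite ?andbF ?andbT ?orbN.
  rewrite phiU; last by move=> x _; case: (D2 _); rewrite ?andbF.
  by rewrite [X in _ * (X * _)]phiV mulVKg.
have -> : phi a^! (fun x => ~~ (D2 (Some x) && (~~ D1 (Some x) || (Some x == Some a)))) =
    phi a^! (fun x => ~~ D2 (Some x) || D1 (Some x)).
  by apply: eq_phi => x xa; rewrite someE (@neq_of_index x a xa) orbF negb_and negbK.
rewrite phiU; last by move=> x _; have := D12 (Some x); case: (D1 _) => [->|]; rewrite ?andbF.
by rewrite (@phiV a (fun x => D1 (Some x))) mulgVK.
Qed.

Lemma wh_conj w D a :
  iW w * wh D a = wh (fun o => D (omap (wl (w_inv w)) o)) (wl w a) * iW w.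
Proof. by rewrite /wh /=; case: (D None); rewrite iW_phi // wl_inv. Qed.

(** Changing the multiplier of a cut. With [A0] the letters of [D] of other index, the inner factors
    [E a^! b * E b a] form a quarter turn times [E a b]. The quarter turn carries [phi b A0] to
    [phi a^! A0], which cancels the [phi a A0] left by [E_phi]. *)
Lemma wh_base_plain D a b : a.1 != b.1 -> D None = false ->
  D (Some a) -> D (Some b) -> ~~ D (Some a^!) -> ~~ D (Some b^!) ->
  wh (flip a D) b * wh D a = iW (wswap b a) * wh D b.
Proof.
move=> ab Dn Da Db Da' Db'; have ba : b.1 != a.1 by rewrite eq_sym.
rewrite /wh (_ : flip a D None = false) // Dn.
pose A0 x := [&& D (Some x), x.1 != a.1 & x.1 != b.1].
have dA0 x : A0 x -> (x.1 != a.1) && (x.1 != b.1) by case/andP.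
have phiE c A : (forall x, x.1 != c.1 -> A x = A0 x) -> phi c A = phi c A0 by apply: eq_phi.
have -> : phi b (fun x => flip a D (Some x)) = phi b A0 * E a^! b.
  rewrite (phiD1 (x := a^!) (a := b)) //; last by rewrite /flip !someE inv_letter_neq eqxx.
  rewrite commute_phi => [|x _ xb]; last exact: commute_same.
  congr (_ * _); apply: phiE => x xb; rewrite /A0 xb andbT (neq_index_letter x a) /flip !someE.
  by case: (x == a); case: (x == a^!); rewrite ?andbF ?andbT.
have -> : phi a (fun x => D (Some x)) = E b a * phi a A0.
  rewrite (phiD1 (x := b) (a := a)) //; congr (_ * _); apply: phiE => x xa.
  rewrite /A0 xa (neq_index_letter x b) /=.
  by case: (eqVneq x b^!) => [->|_]; rewrite ?andbT // (negPf Db').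
have -> : phi b (fun x => D (Some x)) = E a b * phi b A0.
  rewrite (phiD1 (x := a) (a := b)) //; congr (_ * _); apply: phiE => x xb.
  rewrite /A0 xb (neq_index_letter x a) /= andbT.
  by case: (eqVneq x a^!) => [->|_]; rewrite ?andbT // (negPf Da').
have H4 : E a^! b * E b a = iW (wswap b a) * E a b.
  by rewrite -S4 // S1 // mulgVK.
have Hw : phi b A0 * iW (wswap b a) = iW (wswap b a) * phi a^! A0.
  rewrite iW_phi wl_inv wl_swapr // inv_letterK; congr (_ * _); apply: eq_phi => x xb.
  case: (boolP (x.1 == a.1)) => [/eqP xa|xa].
    rewrite /= /A0 xa eqxx /= andbF; apply/esym/negP => /and3P[_ _ /negP]; apply.
    rewrite -(wl_fst (wswap b a)) wlV wl_swapl xa //.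
  by rewrite /= -{2}(wl_swap_out xb xa) wlVK.
have C : commute (E a b) (phi b A0) by apply: commute_phi => x _ xb; apply: commute_same.
rewrite C -mulgA (mulgA (E a^! b)) H4 -!mulgA (mulgA (phi b A0)) Hw -mulgA; congr (_ * _).
by rewrite E_phi // !mulgA (@phiV a) mulVg mul1g.
Qed.

Lemma wh_base D a b : a.1 != b.1 ->
  D (Some a) -> D (Some b) -> ~~ D (Some a^!) -> ~~ D (Some b^!) ->
  exists w, wh (flip a D) b * wh D a = iW w * wh D b.
Proof.
move=> ab Da Db Da' Db'; case Dn: (D None); last first.
  by exists (wswap b a); apply: wh_base_plain.
exists (wswap b^! a^!); rewrite -(wh_compl D) -(wh_compl D b) -wh_base_plain //=.
- congr (_ * _); rewrite -wh_compl; apply: eq_wh => -[x|] //=.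
  rewrite /flip !someE inv_letterK.
  case: eqP => [->|_]; first by rewrite neq_inv_letter.
  by case: eqP.
- by rewrite Dn.
- by rewrite inv_letterK negbK.
- by rewrite inv_letterK negbK.
Qed.

(** * Squares of Whitehead elements with disjoint cuts *)

Section Square.
Variables (D1 D2 : pred (option (letter n))) (a d : letter n).
Hypothesis disj : forall o, ~~ (D1 o && D2 o).
Hypothesis ad : a.1 != d.1.
Hypothesis D1a : D1 (Some a).
Hypothesis D2d : D2 (Some d).
Hypothesis D1a' : ~~ D1 (Some a^!).
Hypothesis D2d' : ~~ D2 (Some d^!).
Hypothesis D1d' : ~~ D1 (Some d^!).

(** The cut of the conjugate of [wh D2 d] by [wh D1 a], again a Whitehead element with multiplier
    [d]. It differs from [D2] only when [D2] separates [a] from [a^!]. *)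
Definition square_set : pred (option (letter n)) := fun o =>
  if D2 (Some a^!) then (D1 o || D2 o) && (o != Some a) else D2 o.

Let da : d.1 != a.1. Proof. by rewrite eq_sym. Qed.
Let D2a : ~~ D2 (Some a). Proof. by have := disj (Some a); rewrite D1a. Qed.
Let D1d : ~~ D1 (Some d). Proof. by have := disj (Some d); rewrite D2d andbT. Qed.
Let D12 x y : D1 (Some x) -> D2 (Some y) -> x != y.
Proof.
by move=> D1x D2y; apply: contraTneq D1x => ->; have := disj (Some y); rewrite D2y andbT.
Qed.
Let D1_d x : D1 (Some x) -> x.1 != d.1.
Proof.
by move=> Dx; rewrite neq_index_letter; apply/andP; split; apply: contraTneq Dx => ->.
Qed.

(** If the base point lies outside both sets, the individual factors commute. If it lies in one of
    them, that element acts through the complement, which contains the letters of the other set and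
    both signs of its multiplier, so [commute_phi_E] applies. *)
Lemma wh_square_commute : ~~ D2 (Some a^!) -> commute (wh D2 d) (wh D1 a).
Proof.
move=> D2a'; have D2_a x : D2 (Some x) -> x.1 != a.1.
  by move=> Dx; rewrite neq_index_letter; apply/andP; split; apply: contraTneq Dx => ->.
rewrite /wh; case D2n: (D2 None); case D1n: (D1 None).
- by have := disj None; rewrite D1n D2n.
- apply: commute_phi => x D1x xa; apply: commute_phi_E => //; first exact: D1_d.
  by have := disj (Some x); rewrite D1x.
- apply/commute_sym/commute_phi => x D2x xd; apply: commute_phi_E => //=; first exact: D2_a.
  by have := disj (Some x); rewrite D2x andbT.
apply: commute_phi => x D1x xa; apply/commute_sym/commute_phi => y D2y yd.
by apply: S2 => //; [exact: D12|exact: D1_d|exact: D2_a].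
Qed.

Section Linked.
Hypothesis D2a' : D2 (Some a^!).

Let A1 x := D1 (Some x) && (x != a).
Let A2 x := D2 (Some x) && (x != a^!).
Let mid x := ~~ D1 (Some x) && ~~ D2 (Some x).

Let A1_ad x : A1 x -> (x.1 != a.1) && (x.1 != d.1).
Proof.
case/andP=> D1x xa; rewrite D1_d // andbT neq_index_letter xa.
by apply: contraTneq D1x => ->.
Qed.

Let A2_a x : A2 x -> x.1 != a.1.
Proof.
case/andP=> D2x xa'; rewrite neq_index_letter xa' andbT.
by apply: contraTneq D2x => ->.
Qed.

Let mid_a x : mid x -> x.1 != a.1.
Proof.
case/andP=> D1x D2x; rewrite neq_index_letter; apply/andP; split.
  by apply: contraNneq D1x => ->.
by apply: contraNneq D2x => ->.
Qed.

Let phiA1 : phi a (fun x => D1 (Some x)) = phi a A1.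
Proof. by apply: eq_phi => x xa; rewrite /A1 (@neq_of_index x a xa) andbT. Qed.

Let phiA2 : phi d (fun x => D2 (Some x)) = E a^! d * phi d A2.
Proof. by rewrite (@phiD1 d _ a^!). Qed.

Let square_none : square_set None = D1 None || D2 None.
Proof. by rewrite /square_set D2a' andbT. Qed.

Let squareE x : square_set (Some x) = (D1 (Some x) || D2 (Some x)) && (x != a).
Proof. by rewrite /square_set D2a'. Qed.

Let mid_squareE : phi d^! (fun x => ~~ square_set (Some x)) = E a d^! * phi d^! mid.
Proof.
rewrite (@phiD1 d^! _ a) //=; last by rewrite squareE eqxx andbF.
congr (_ * _); apply: eq_phi => x _; rewrite squareE /mid negb_and negb_or negbK.
by case: (eqVneq x a) => [->|_]; rewrite ?andbT ?orbF // D1a andbF.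
Qed.

Let commute_A1 A : (forall x, A x -> x.1 != a.1) -> (forall x, A1 x -> A x = false) ->
  commute (phi d A) (phi a A1).
Proof.
move=> Aa A1A; apply: commute_phi => x A1x xa; apply/commute_sym/commute_phi => y Ay yd.
have /andP[xa1 xd] := A1_ad A1x.
apply: S2 => //; last exact: Aa.
by apply: contraTneq Ay => <-; rewrite A1A.
Qed.

(** Base point outside both sets: [E a^! d] is the one factor of [wh D2 d] not known to commute with
    [wh D1 a], and [E_phiV] corrects it by [phi d A1], which is what enlarges the cut. *)
Lemma square_linked_mid : D1 None = false -> D2 None = false ->
  wh square_set d * wh D1 a = wh D1 a * wh D2 d.
Proof.
move=> D1n D2n; rewrite /wh square_none D1n D2n /= phiA1.
have -> : phi d (fun x => square_set (Some x)) = phi d A1 * phi d (fun x => D2 (Some x)).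
  rewrite -phiU => [|x _]; last first.
    by rewrite /A1; have := disj (Some x); case: (D1 _) => //= /negPf->; rewrite andbF.
  apply: eq_phi => x _; rewrite squareE /A1; case: (eqVneq x a) => [->|_].
    by rewrite !andbF (negPf D2a).
  by rewrite !andbT.
have C2 : commute (phi d A2) (phi a A1).
  apply: commute_A1 => // x /andP[D1x _]; rewrite /A2.
  by have := disj (Some x); rewrite D1x /= => /negPf->.
have C12 : commute (phi d A1) (phi d A2).
  by apply: commute_phi => x _ xd; apply/commute_sym/commute_phi => y _ yd; apply: commute_same.
have H := E_phiV ad A1_ad; rewrite phiA2.
have C3 : commute (E a^! d) (phi d A2).
  by apply: commute_phi => x _ xd; apply: commute_same.
rewrite C3 !mulgA -[LHS]mulgA H phiV !mulgA C12 mulgK.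
by rewrite C2.
Qed.

(** Base point in [D1]: [phi_E] moves [E a^! d] past the complement of [D1] at the cost of [phi d^!]
    on that complement, and [phi d A2] cuts this down to [mid]. *)
Lemma square_linked_left : D1 None -> D2 None = false ->
  wh square_set d * wh D1 a = wh D1 a * wh D2 d.
Proof.
move=> D1n D2n; rewrite /wh square_none D1n D2n /= phiA2.
pose A x := ~~ D1 (Some x) && (x.1 != a.1).
have -> : phi a^! (fun x => ~~ D1 (Some x)) = phi a^! A.
  by apply: eq_phi => x /= xa; rewrite /A xa andbT.
have H : phi a^! A * E a^! d = E a d^! * phi d^! A * phi a^! A.
  by apply: phi_E => //; rewrite ?/A ?D1d ?D1d' // => x /andP[].
have C : commute (phi a^! A) (phi d A2).
  apply: commute_phi => y A2y yd; have ya := A2_a A2y.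
  apply: commute_phi_E => //; rewrite /A ?D1d ?D1d' // ya andbT.
  by have := disj (Some y); case/andP: A2y => -> _; rewrite andbT.
rewrite mulgA H -mulgA C mulgA; congr (_ * _).
have -> : phi d A2 = (phi d^! A2)^-1 by rewrite phiV invgK.
apply: (mulIg (phi d^! A2)); rewrite /= mulgVK mid_squareE -mulgA; congr (_ * _).
rewrite -phiU => [|x _]; last by rewrite /mid /A2; case: (D2 _); rewrite ?andbF.
apply: eq_phi => x _; rewrite /mid /A2 /A neq_index_letter.
have := disj (Some x); case D1x: (D1 _) => /=; first by move/negPf->.
case: (eqVneq x a) => [xa|_] _; first by rewrite xa D1a in D1x.
by case: (eqVneq x a^!) => [->|_]; rewrite ?D2a' //; case: (D2 _).
Qed.

(** Base point in [D2]: the complement of [D2] contains [a], and moving [E a d^!] past [phi a A1] by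
    [E_phi] supplies the missing [phi d^! A1]. *)
Lemma square_linked_right : D1 None = false -> D2 None ->
  wh square_set d * wh D1 a = wh D1 a * wh D2 d.
Proof.
move=> D1n D2n; rewrite /wh square_none D1n D2n /= phiA1.
have -> : phi d^! (fun x => ~~ D2 (Some x)) = phi d^! A1 * (E a d^! * phi d^! mid).
  rewrite -mid_squareE -phiU => [|x _]; last first.
    by rewrite squareE /A1; case: (D1 _) => //=; case: (x != a).
  apply: eq_phi => x _; rewrite squareE /A1.
  have := disj (Some x); case: (eqVneq x a) => [->|_]; first by rewrite D1a andbF /= => ->.
  by case: (D1 _) => /= [/negPf-> | _]; rewrite ?andbT.
rewrite mid_squareE.
have C : commute (phi d^! mid) (phi a A1).
  rewrite phiV; apply/commute_sym/commuteV/commute_sym/commute_A1 => //.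
  by move=> x /andP[D1x _]; rewrite /mid D1x.
have H := @E_phi a d^! A1 ad A1_ad.
by rewrite -mulgA C !mulgA H.
Qed.

End Linked.

Lemma wh_square : wh square_set d * wh D1 a = wh D1 a * wh D2 d.
Proof.
case D2a' : (D2 (Some a^!)); last first.
  have -> : wh square_set d = wh D2 d.
    by apply: eq_wh => o; rewrite /square_set D2a'.
  by apply: wh_square_commute; rewrite D2a'.
case D1n: (D1 None); case D2n: (D2 None).
- by have := disj None; rewrite D1n D2n.
- exact: square_linked_left.
- exact: square_linked_right.
- exact: square_linked_mid.
Qed.

End Square.
End Whitehead.

(** * Cuts of the star graph *)

Section Cuts.
Variable n : nat.
Implicit Types (x y a : letter n) (u v : seq (letter n)).
Implicit Types (D : pred (option (letter n))) (s t : option (letter n)).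

(* The path [u] leaves in direction [s] and ends at the base point [None]; its turn between
   consecutive letters [x y] joins the directions [x] and [y^!]. *)
Fixpoint cut D s u : nat :=
  if u is x :: u' then (D s != D (Some x^!)) + cut D (Some x) u' else (D s != D None).

(** Cancelling [x x^!] removes a turn that crosses nothing and merges its two neighbours, so the
    triangle inequality applies. *)
Lemma cut_reduce D s u : cut D s (reduce u) <= cut D s u.
Proof.
elim: u s => [|x u IH] s //; rewrite reduce_cons /=.
have := IH (Some x); case: (reduce u) => [|y v]; rewrite /= ?leq_add2l //.
case: (y =P x^!) => [->|_] /=; last by rewrite leq_add2l.
rewrite inv_letterK eqxx add0n.
case: v => [|z v] /=.
  by case: (D s); case: (D None); case: (D (Some x^!)) => /=; lia.
by case: (D s); case: (D (Some z^!)); case: (D (Some x^!)) => /=; lia.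
Qed.

Lemma count_reduce (P : pred (letter n)) u : count P (reduce u) <= count P u.
Proof.
elim: u => // x u IH; rewrite reduce_cons /=.
by case: (reduce u) IH => [|y v] /=; [|case: ifP => _ /=]; lia.
Qed.

Lemma eq_cut D1 D2 s u : D1 =1 D2 -> cut D1 s u = cut D2 s u.
Proof. by move=> D12; elim: u s => [|x u IH] s /=; rewrite ?IH !D12. Qed.

Lemma cut_compl D s u : cut (predC D) s u = cut D s u.
Proof. elim: u s => [|x u IH] s /=; rewrite ?IH; first by case: (D s); case: (D None).
by case: (D s); case: (D (Some x^!)). Qed.

Lemma cut_submodular D1 D2 s u :
  cut (predI D1 D2) s u + cut (predU D1 D2) s u <= cut D1 s u + cut D2 s u.
Proof.
elim: u s => [|x u IH] s /=.
  by case: (D1 s); case: (D2 s); case: (D1 None); case: (D2 None).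
have := IH (Some x).
by case: (D1 s); case: (D2 s); case: (D1 (Some x^!)); case: (D2 (Some x^!)) => /=; lia.
Qed.

Definition deg a u := count (fun x => x.1 == a.1) u.

Definition away a u := count (fun x => x.1 != a.1) u.

Lemma count_deg a u : away a u + deg a u = size u.
Proof. by rewrite addnC -(count_predC (fun x => x.1 == a.1)). Qed.

(** A general turn cost, because two successive Whitehead elements are measured by two cuts at
    once. *)
Fixpoint turns (c : option (letter n) -> option (letter n) -> nat) s u : nat :=
  if u is x :: u' then c s (Some x^!) + turns c (Some x) u' else c s None.

Lemma turns_cut D s u : turns (fun s t => D s != D t) s u = cut D s u.
Proof. by elim: u s => [|x u IH] s //=; rewrite IH. Qed.

Lemma turnsD c1 c2 s u :
  turns (fun s t => c1 s t + c2 s t)%N s u = turns c1 s u + turns c2 s u.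
Proof. by elim: u s => [|x u IH] s //=; rewrite IH addnACA. Qed.

End Cuts.

(** * Length change under a Whitehead automorphism *)

Section CutBounds.
Variables (n : nat) (f : fgroup n -> fgroup n).
Hypothesis fM : {morph f : u v / u * v}.
Implicit Types (x y a : letter n) (s t : option (letter n)).

(* [f] is determined by a potential [h] on directions: every letter outside [S] is kept and a turn
   from [s] to [t] contributes [h s * (h t)^-1]. *)
Lemma size_potential (h : option (letter n) -> fgroup n) (S : pred (letter n)) c :
  (forall y, f (fgen y) = h None * (h (Some y^!))^-1 *
     (if S y then 1 else fgen y) * h (Some y) * (h None)^-1) ->
  (forall s t, size (h s * (h t)^-1) <= c s t) ->
  forall u, size (f u) <= count (predC S) u + turns c None u.
Proof.
move=> fE hc u.
have -> : f u = h None * (h None)^-1 * f u by rewrite mulgV mul1g.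
rewrite -{1}(fg_ofP u); elim: (fword u) {1 3}None => [|y v IH] s.
  by rewrite fg_of_nil (morph1_group fM) mulg1.
have -> : fg_of (y :: v) = fgen y * fg_of v by rewrite -fg_of_cat.
rewrite fM fE !mulgA mulgVK -!mulgA (mulgA (h s)) (mulgA (h (Some y))).
apply: leq_trans (size_fgM _ _) _.
apply: leq_trans (leq_add (hc _ _) (size_fgM _ _)) _.
rewrite [turns _ _ _]/= [count _ _]/=; have := IH (Some y).
rewrite /predC; case: (S y); rewrite ?fword1 ?fword_gen /= => H; lia.
Qed.

Variables (a : letter n) (D : pred (option (letter n))).
Hypothesis (Da : D (Some a)) (Da' : ~~ D (Some a^!)).

(** Written with a potential so that the two sides of the cut play symmetric roles. The multiplier
    itself arises as the potential difference between the directions [a] and [a^!]. *)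
Definition wh_letter (y : letter n) : fgroup n :=
  let h o : fgroup n := if D o then fgen a else 1 in
  h None * (h (Some y^!))^-1 * (if y.1 == a.1 then 1 else fgen y) * h (Some y) * (h None)^-1.

Hypothesis fE : forall y, f (fgen y) = wh_letter y.

Lemma size_wh_le u : size (f u) <= away a u + cut D None u.
Proof.
rewrite -turns_cut; apply: size_potential fE _ u => s t.
case: (D s); case: (D t); rewrite ?mulgV ?mulg1 ?mul1g ?invg1 ?fwordV ?fword1 ?fword_gen //.
Qed.

Let block y := if y.1 == a.1 then [:: y]
  else nseq (D (Some y^!)) a^! ++ y :: nseq (D (Some y)) a.

Let fg_block : D None = false -> forall u, f (fg_of u) = fg_of (flatten (map block u)).
Proof.
move=> Dn; elim=> [|y u IH]; first by rewrite fg_of_nil (morph1_group fM).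
rewrite /= fg_of_cat -IH -cat1s fg_of_cat fM; congr (_ * _).
rewrite -/(fgen y) fE /wh_letter Dn /block invg1 mulg1 mul1g; case: eqP => [ya|_].
  have [->|->] := same_index ya; first by rewrite Da (negPf Da') invg1 !mul1g.
  by rewrite inv_letterK Da (negPf Da') !mulg1 -fgenV.
rewrite fg_of_cat -cat1s fg_of_cat mulgA; congr (_ * _ * _).
  by case: (D _); rewrite -?fgenV ?invg1.
by case: (D _).
Qed.

(** A turn made by inserting [a] or [a^!] has both directions on one side of [flip a D], so only
    letters of [u] of the index of [a] pay for crossings. The summand for [s] is a crossing still
    pending when the path leaves from inside. *)
Let cut_block : D None = false -> forall u s,
  cut (flip a D) s (flatten (map block u)) <= (flip a D s : nat) + deg a u.
Proof.
move=> Dn; have fa : flip a D (Some a) = false by rewrite /flip eqxx.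
have fa' : flip a D (Some a^!) = true.
  by rewrite /flip !someE inv_letter_neq eqxx.
have fN : flip a D None = false by [].
have fD y : y.1 != a.1 -> flip a D (Some y) = D (Some y).
  by move=> ya; rewrite /flip !someE !(neq_of_index ya).
elim=> [|y u IH] s /=; first by rewrite fN; case: (flip a D s).
rewrite {1}/block; case: (boolP (y.1 == a.1)) => [/eqP ya|ya] /=; last first.
  have ya' : (y^!).1 != a.1 by [].
  have IHy := IH (Some y); have IHa := IH (Some a); rewrite fD // in IHy; rewrite fa in IHa.
  case Dy' : (D (Some y^!)); case Dy: (D (Some y)) => /=;
    rewrite ?inv_letterK ?fa ?fa' ?fD // ?Dy ?Dy' ?eqxx ?add0n; rewrite ?Dy ?add0n in IHy IHa;
    case: (flip a D s); rewrite ?eqxx ?add0n ?leq_add2l //.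
have [->|->] := same_index ya; rewrite ?inv_letterK ?fa ?fa'.
  by have := IH (Some a); rewrite fa; case: (flip a D s); rewrite /= !add0n; lia.
by have := IH (Some a^!); rewrite fa'; case: (flip a D s); rewrite /= ?add0n; lia.
Qed.

Lemma size_wh_ge_plain : D None = false -> forall u,
  cut (flip a D) None (f u) <= deg a u /\
  away a (f u) <= away a u.
Proof.
move=> Dn u; rewrite -{1 3}(fg_ofP u) fg_block //; split.
  apply: leq_trans (cut_reduce _ _ _) _; apply: leq_trans (cut_block Dn _ _) _.
  by rewrite (_ : flip a D None = false).
apply: leq_trans (count_reduce _ _) _; rewrite leq_eqVlt; apply/orP; left; apply/eqP.
elim: (fword u) => //= y v IH; rewrite count_cat IH; congr (_ + _)%N.
rewrite /block; case ya: (y.1 == a.1) => /=; first by rewrite ya.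
by rewrite count_cat /= !count_nseq /= eqxx ya /= !mul0n.
Qed.

End CutBounds.

Section CutExact.
Variable n : nat.
Implicit Types (f : fgroup n -> fgroup n) (a y : letter n) (D : pred (option (letter n))).

(** Complementing the cut multiplies the potential on the right by the inverse of [a], which cancels
    in every quotient. *)
Lemma wh_letter_compl a D y : wh_letter a^! (predC D) y = wh_letter a D y.
Proof.
rewrite /wh_letter /= fgenV.
have K o : (if ~~ D o then (fgen a)^-1 else 1) = (if D o then fgen a else 1) * (fgen a)^-1.
  by case: (D o); rewrite ?mulgV ?mul1g.
by rewrite !K !invgM invgK !mulgA !mulgVK.
Qed.

Lemma flip_compl a D : flip a^! (predC D) =1 predC (flip a D).
Proof.
case=> [x|] //=; rewrite /flip !someE inv_letterK.
case: (eqVneq x a^!) => [->|_]; first by rewrite inv_letter_neq.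
by case: (x == a).
Qed.

Lemma flipK a D : D (Some a) -> ~~ D (Some a^!) -> flip a^! (flip a D) =1 D.
Proof.
move=> Da Da' [x|] //=; rewrite /flip !someE inv_letterK.
case: (eqVneq x a^!) => [->|_]; first by rewrite (negPf Da').
by case: (eqVneq x a) => [->|].
Qed.

Lemma size_wh_ge f a D : {morph f : u v / u * v} ->
  D (Some a) -> ~~ D (Some a^!) -> (forall y, f (fgen y) = wh_letter a D y) ->
  forall u, cut (flip a D) None (f u) <= deg a u /\
    away a (f u) <= away a u.
Proof.
move=> fM Da Da' fE u; case Dn: (D None); last exact: size_wh_ge_plain.
rewrite -(@cut_compl _ (flip a D)) -(eq_cut _ _ (flip_compl a D)).
apply: (@size_wh_ge_plain _ f fM a^! (predC D)) => //=; rewrite ?inv_letterK ?Da ?Dn //.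
by move=> y; rewrite fE wh_letter_compl.
Qed.

(* The lower bound on [size (f u)] comes from applying [size_wh_ge] to the inverse of [f], whose cut
   is [flip a D]. *)
Lemma size_wh f f' a D : {morph f : u v / u * v} -> {morph f' : u v / u * v} ->
  cancel f f' -> D (Some a) -> ~~ D (Some a^!) ->
  (forall y, f (fgen y) = wh_letter a D y) ->
  (forall y, f' (fgen y) = wh_letter a^! (flip a D) y) ->
  forall u, (size (f u) + deg a u = size u + cut D None u)%N.
Proof.
move=> fM f'M fK Da Da' fE f'E u.
have [_ C1] := size_wh_ge fM Da Da' fE u.
have U := size_wh_le fM fE u.
have [] := @size_wh_ge f' a^! (flip a D) f'M _ _ f'E (f u).
- by rewrite /flip !someE inv_letter_neq eqxx.
- by rewrite /flip !someE inv_letterK eqxx.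
rewrite fK (eq_cut _ _ (flipK Da Da')) -/(deg a (f u)) => C3 C2.
have {}C2 : away a u <= away a (f u) by [].
have {}C3 : cut D None u <= deg a (f u) by [].
have := count_deg a u; have := count_deg a (f u); move: C1 C2 C3 U.
by clear; lia.
Qed.

End CutExact.

(** * Peak reduction *)

Section Peaks.
Variables (n : nat) (G : groupType) (iW : wn n -> G) (E : letter n -> letter n -> G).
Variable act : G -> fgroup n -> fgroup n.
Hypothesis St : steinberg iW E.
Hypothesis Sa : steinberg_action iW E act.
Implicit Types (w : wn n) (x y z a b d : letter n) (g h k : G) (u v : fgroup n).
Implicit Types A B D : pred (option (letter n)).

Let actM := sa_actM Sa.
Let act1 := sa_act1 Sa.
Let actm := sa_morph Sa.
Let W := wh E.

Lemma act_E_inv x y : x.1 != y.1 -> act (E x y) (fgen x^!) = (fgen y)^-1 * fgen x^!.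
Proof.
move=> xy; rewrite !fgenV (morphV_group (@actm _)) (sa_E Sa) // invgM.
by [].
Qed.

Lemma act_phi_fix a (A : pred (letter n)) y : ~~ A y -> ~~ A y^! ->
  act (phi E a A) (fgen y) = fgen y.
Proof.
move=> Ay Ay'; rewrite /phi; apply: (big_ind (fun g => act g (fgen y) = fgen y)).
- exact: act1.
- by move=> g h gy hy; rewrite actM hy.
move=> x /andP[Ax xa]; apply: (sa_E_out Sa) => //; rewrite eq_sym neq_index_letter.
by apply/andP; split; apply: contraTneq Ax => ->.
Qed.

Lemma act_phi a (A : pred (letter n)) y : y.1 != a.1 ->
  act (phi E a A) (fgen y) =
  (if A y^! then fgen a else 1)^-1 * fgen y * (if A y then fgen a else 1).
Proof.
move=> ya; have y'a : (y^!).1 != a.1 by [].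
have Ea : act (E y a) (fgen a) = fgen a by rewrite (sa_E_out Sa) // eq_sym.
have E'a : act (E y^! a) (fgen a) = fgen a by rewrite (sa_E_out Sa) // eq_sym.
have yy : y != y^! by rewrite neq_inv_letter.
have E'y : act (E y^! a) (fgen y) = (fgen a)^-1 * fgen y.
  by rewrite -{2 3}(inv_letterK y) act_E_inv.
case Ay: (A y); case Ay': (A y^!); rewrite ?invg1 ?mulg1 ?mul1g.
- rewrite (phiD1 St ya Ay) (phiD1 St y'a (A := fun x => _ && _)) ?Ay' ?inv_letter_neq //.
  rewrite !actM act_phi_fix ?eqxx ?andbF //.
  by rewrite E'y actm (morphV_group (@actm _)) Ea (sa_E Sa) // mulgA.
- rewrite (phiD1 St ya Ay) actM act_phi_fix ?eqxx ?andbF ?Ay' //.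
  by rewrite (sa_E Sa).
- rewrite (phiD1 St y'a Ay') actM act_phi_fix ?eqxx ?andbF ?Ay //.
by rewrite act_phi_fix ?Ay ?Ay'.
Qed.

Lemma act_wh D a y : D (Some a) -> ~~ D (Some a^!) ->
  act (W D a) (fgen y) = wh_letter a D y.
Proof.
have plain D' b z : D' None = false -> D' (Some b) -> ~~ D' (Some b^!) ->
    act (W D' b) (fgen z) = wh_letter b D' z.
  move=> Dn Db Db'; rewrite /W /wh Dn /wh_letter Dn invg1 mulg1 mul1g.
  case: (boolP (z.1 == b.1)) => [/eqP zb|zb]; last by rewrite act_phi.
  have [->|->] := same_index zb; rewrite ?inv_letterK Db (negPf Db').
    rewrite /phi invg1 !mul1g; apply: (big_ind (fun g => act g (fgen b) = fgen b)).
    - exact: act1.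
    - by move=> g h gy hy; rewrite actM hy.
    by move=> x /andP[_ xb]; apply: (sa_E_out Sa) => //; rewrite eq_sym.
  rewrite /phi !mulg1 -fgenV; apply: (big_ind (fun g => act g (fgen b^!) = fgen b^!)).
  - exact: act1.
  - by move=> g h gy hy; rewrite actM hy.
  by move=> x /andP[_ xb]; apply: (sa_E_out Sa) => //; rewrite eq_sym.
move=> Da Da'; case Dn: (D None); last exact: plain.
by rewrite -wh_letter_compl /W -(wh_compl E) plain //= ?Dn ?inv_letterK ?Da.
Qed.

Definition norm g : nat := \sum_(i < n) size (act g (fgen (i, false))).
Definition gcut D g : nat := \sum_(i < n) cut D None (act g (fgen (i, false))).
Definition gdeg a g : nat := \sum_(i < n) deg a (act g (fgen (i, false))).

Lemma norm_wh D a g : D (Some a) -> ~~ D (Some a^!) ->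
  (norm (W D a * g) + gdeg a g = norm g + gcut D g)%N.
Proof.
move=> Da Da'; rewrite /norm /gdeg /gcut -!big_split /=; apply: eq_bigr => i _.
rewrite actM; apply: (@size_wh _ (act (W D a)) (act (W (flip a D) a^!))) => //.
- by move=> u; rewrite -actM /W (wh_flip St) mulVg act1.
- by move=> y; apply: act_wh.
move=> y; apply: act_wh; first by rewrite /flip !someE inv_letter_neq eqxx.
by rewrite /flip !someE inv_letterK eqxx.
Qed.

(** The composite has the single potential [j * k], since [W D1 a] changes [d] only by a conjugation
    that the potential absorbs. Disjointness keeps the values among [1], [a] and [d], so a turn
    costs at most the number of cuts it crosses. *)
Lemma norm_square D1 D2 a d g : (forall o, ~~ (D1 o && D2 o)) -> a.1 != d.1 ->
  D1 (Some a) -> D2 (Some d) -> ~~ D1 (Some a^!) -> ~~ D2 (Some d^!) -> ~~ D1 (Some d^!) ->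
  (norm (W D1 a * W D2 d * g) + gdeg a g + gdeg d g <= norm g + gcut D1 g + gcut D2 g)%N.
Proof.
move=> disj ad D1a D2d D1a' D2d' D1d'.
rewrite /norm /gdeg /gcut -!big_split /=; apply: leq_sum => i _.
rewrite actM; move: (act g _) => u.
pose S y := (y.1 == a.1) || (y.1 == d.1).
pose h o : fgroup n := (if D1 o then fgen a else 1) * (if D2 o then fgen d else 1).
have D1d : D1 (Some d) = false by have := disj (Some d); rewrite D2d andbT => /negPf.
have count_S : (count (predC S) u + deg a u + deg d u)%N = size u.
  rewrite /deg /S; elim: (fword u) => //= y v IH.
  case: (eqVneq y.1 a.1) => [ya|_] /=; first by rewrite ya (negPf ad); lia.
  by case: (y.1 == d.1) => /=; lia.
pose j o : fgroup n := if D1 o then fgen a else 1.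
pose k o : fgroup n := if D2 o then fgen d else 1.
suff: (size (act (W D1 a * W D2 d) u) <= count (predC S) u +
    turns (fun s t => (D1 s != D1 t) + (D2 s != D2 t))%N None u)%N.
  by rewrite turnsD !turns_cut; move: count_S; clear; lia.
apply: (size_potential (@actm _) (h := fun o => j o * k o)) => [y|s t]; last first.
  have ss := disj s; have tt := disj t; rewrite /j /k.
  case: (D1 s) ss; case: (D2 s) => // _; case: (D1 t) tt; case: (D2 t) => // _;
    rewrite ?(mulg1, mul1g, invg1, mulgV) ?size_fgV ?fword_gen //;
    by apply: leq_trans (size_fgM _ _) _; rewrite size_fgV.
have actV g' : {morph act g' : v / v^-1} by apply/morphV_group/actm.
have act_k o : act (W D1 a) (k o) = j None * k o * (j None)^-1.
  rewrite /k; case: (D2 o); last by rewrite (morph1_group (@actm _)) mulg1 mulgV.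
  rewrite act_wh // /wh_letter eq_sym (negPf ad) D1d (negPf D1d') invg1 !mulg1.
  by [].
rewrite actM act_wh // /wh_letter -!/(k _) !(actm, actV, act_k).
have -> : act (W D1 a) (if y.1 == d.1 then 1 else fgen y) =
   j None * (j (Some y^!))^-1 * (if S y then 1 else fgen y) * j (Some y) * (j None)^-1.
  rewrite /S orbC; case: (boolP (y.1 == d.1)) => [/eqP yd|yd] /=; last by rewrite act_wh.
  rewrite (morph1_group (@actm _)) /j.
  have [->|->] := same_index yd; rewrite ?inv_letterK D1d (negPf D1d') invg1 !mulg1;
    by rewrite mulgV.
by rewrite !invgM !invgK !mulgA !mulgVK.
Qed.

Lemma norm_iW w g : norm (iW w * g) = norm g.
Proof.
have le (v : wn n) u : (size (act (iW v) u) <= size u)%N.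
  have -> : act (iW v) u = fg_of (map (wl v) u).
    rewrite -{1}(fg_ofP u); elim: (fword u) => [|x s IH] /=.
      by rewrite fg_of_nil (morph1_group (@actm _)).
    by rewrite -cat1s fg_of_cat actm IH (sa_W Sa) -[in RHS]cat1s fg_of_cat.
  by apply: leq_trans (size_reduce _) _; rewrite size_map.
apply: eq_bigr => i _; rewrite actM; apply/eqP; rewrite eqn_leq le /=.
move: (act g _) => u; have := le (w_inv w) (act (iW w) u).
rewrite -actM -(stWM St) (_ : wmul _ _ = wone n) ?(stW1 St) ?act1 //.
by apply/wn_ext => x; rewrite wlM wlVK wl1.
Qed.

Lemma gcut_compl D g : gcut (predC D) g = gcut D g.
Proof. by apply: eq_bigr => i _; apply: cut_compl. Qed.

Lemma eq_gcut D1 D2 g : D1 =1 D2 -> gcut D1 g = gcut D2 g.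
Proof. by move=> D12; apply: eq_bigr => i _; apply: eq_cut. Qed.

Lemma gcut_submodular D1 D2 g :
  (gcut (predI D1 D2) g + gcut (predU D1 D2) g <= gcut D1 g + gcut D2 g)%N.
Proof. by rewrite -!big_split /=; apply: leq_sum => i _; apply: cut_submodular. Qed.

Lemma gdegV a g : gdeg a^! g = gdeg a g. Proof. by []. Qed.

(** The factor from [W_n] absorbs the quarter turn of [wh_base]; it leaves [norm] unchanged. *)
Definition edge g h := exists w D a, [/\ D (Some a), ~~ D (Some a^!) & h = iW w * W D a * g].

Lemma edge_iW w g h : edge g h -> edge g (iW w * h).
Proof.
case=> v [D [a [Da Da' ->]]]; exists (wmul w v), D, a; split=> //.
by rewrite (stWM St) !mulgA.
Qed.

Lemma iWV w : (iW w)^-1 = iW (w_inv w).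
Proof.
apply: mulg1_eq; rewrite -(stWM St) -(stW1 St); congr iW.
by apply/wn_ext => x; rewrite wlM wlV wl1.
Qed.

Lemma flip_valid D a : D (Some a) -> ~~ D (Some a^!) ->
  flip a D (Some a^!) /\ ~~ flip a D (Some a^!^!).
Proof. by rewrite /flip !someE inv_letterK inv_letter_neq !eqxx. Qed.

Lemma edge_sym g h : edge g h -> edge h g.
Proof.
case=> w [D [a [Da Da' ->]]]; have [Fa Fa'] := flip_valid Da Da'.
exists (w_inv w), (fun o => flip a D (omap (wl (w_inv w)) o)), (wl w a^!); split=> /=.
- by rewrite wlVK.
- by rewrite -wl_inv wlVK.
apply: (mulgI (iW w)); rewrite /= -iWV mulgA mulVKg.
have H : iW w * (W D a)^-1 =
    W (fun o => flip a D (omap (wl (w_inv w)) o)) (wl w a^!) * iW w.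
  by rewrite /W -(wh_flip St) (wh_conj St).
by rewrite -[iW w * W D a * g]mulgA mulgA -H -mulgA mulKg.
Qed.

(** Only interior vertices are bounded: one end of a peak may be as long as its top. *)
Inductive conn (N : nat) : G -> G -> Prop :=
| conn_edge g h of edge g h : conn N g h
| conn_step g k h of edge g k & norm k < N & conn N k h : conn N g h.

Lemma conn_trans N g k h : conn N g k -> norm k < N -> conn N k h -> conn N g h.
Proof.
elim=> [{}g {}k e|{}g k' {}k e k'N _ IH] kN kh; first exact: conn_step kh.
by apply: conn_step e k'N _; apply: IH.
Qed.

Lemma conn_sym N g h : conn N g h -> conn N h g.
Proof.
elim=> [{}g {}h /edge_sym|{}g k {}h /edge_sym e kN _ IH]; first exact: conn_edge.
by apply: conn_trans IH kN _; apply: conn_edge.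
Qed.

Lemma edge_wh g D a : D (Some a) -> ~~ D (Some a^!) -> edge g (W D a * g).
Proof. by exists (wone n), D, a; rewrite (stW1 St) mul1g. Qed.

Lemma edge_nested D1 D2 a g : (forall o, D1 o -> D2 o) -> D1 (Some a) -> ~~ D2 (Some a^!) ->
  edge (W D1 a * g) (W D2 a * g).
Proof.
move=> D12 Da Da'; rewrite /W (wh_nested St a D12) -mulgA; apply: edge_wh.
  by rewrite D12 // eqxx orbT.
by rewrite (negPf Da').
Qed.

Lemma edge_base D a b g : a.1 != b.1 ->
  D (Some a) -> D (Some b) -> ~~ D (Some a^!) -> ~~ D (Some b^!) ->
  edge (W D a * g) (W D b * g).
Proof.
move=> ab Da Db Da' Db'; have [w H] := wh_base St ab Da Db Da' Db'.
have ba : b.1 != a.1 by rewrite eq_sym.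
exists (w_inv w), (flip a D), b; split.
- by rewrite /flip !someE !(neq_of_index ba) Db.
- by rewrite /flip !someE !(@neq_of_index _ b^! a ba) (negPf Db').
by rewrite -iWV -!mulgA (mulgA (W (flip a D) b)) /W H -!mulgA mulKg.
Qed.

Lemma W_compl D a : W (predC D) a^! = W D a.
Proof. exact: wh_compl. Qed.

Lemma norm_wh_lt D a g : D (Some a) -> ~~ D (Some a^!) ->
  (norm (W D a * g) < norm g) = (gcut D g < gdeg a g).
Proof. by move=> Da Da'; have := norm_wh g Da Da'; clear; lia. Qed.

Lemma norm_wh_leq D a g : D (Some a) -> ~~ D (Some a^!) ->
  (norm (W D a * g) <= norm g) = (gcut D g <= gdeg a g).
Proof. by move=> Da Da'; have := norm_wh g Da Da'; clear; lia. Qed.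

Lemma conn_square D1 D2 a d g : (forall o, ~~ (D1 o && D2 o)) -> a.1 != d.1 ->
  D1 (Some a) -> D2 (Some d) -> ~~ D1 (Some a^!) -> ~~ D2 (Some d^!) -> ~~ D1 (Some d^!) ->
  gcut D1 g + gcut D2 g < gdeg a g + gdeg d g ->
  conn (norm g) (W D1 a * g) (W D2 d * g).
Proof.
move=> disj ad D1a D2d D1a' D2d' D1d' lt_cut.
have N := norm_square g disj ad D1a D2d D1a' D2d' D1d'.
apply: (@conn_step _ _ (W D1 a * W D2 d * g)); last 2 first.
- by move: N lt_cut; clear; lia.
- by apply/conn_edge/edge_sym; rewrite -mulgA; apply: edge_wh.
rewrite /W -(wh_square St disj ad) // -mulgA; apply: edge_wh.
  rewrite /square_set D2d orbT /= someE; case: ifP => // _.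
  by apply: contraNneq ad => ->.
by rewrite /square_set (negPf D1d') (negPf D2d'); case: ifP.
Qed.

(* When [D1] and [D2] separate both [a] and [d], the two cuts may exchange their multipliers. *)
Lemma conn_linked D1 D2 a d g : (forall o, ~~ (D1 o && D2 o)) -> a.1 != d.1 ->
  D1 (Some a) -> D2 (Some d) -> ~~ D1 (Some a^!) -> ~~ D2 (Some d^!) -> D1 (Some d^!) ->
  gcut D1 g < gdeg d g -> conn (norm g) (W D1 a * g) (W D2 d * g).
Proof.
move=> disj ad D1a D2d D1a' D2d' D1d' lt_cut.
have D1d : ~~ D1 (Some d^!^!).
  by rewrite inv_letterK; have := disj (Some d); rewrite D2d andbT.
apply: (@conn_step _ _ (W D1 d^! * g)); first exact: edge_base.
  by rewrite norm_wh_lt.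
apply: conn_edge; rewrite -(W_compl D2); apply: edge_nested => //=.
  by move=> o D1o; have := disj o; rewrite D1o.
by rewrite inv_letterK D2d.
Qed.

(** If one cut does not separate the multiplier of the other from its inverse, the square closes
    below [g]. Otherwise the multipliers can be exchanged, and the strict inequality makes at least
    one of the exchanged elements shorten [g]. *)
Lemma conn_disjoint D1 D2 a d g : (forall o, ~~ (D1 o && D2 o)) -> a.1 != d.1 ->
  D1 (Some a) -> D2 (Some d) -> ~~ D1 (Some a^!) -> ~~ D2 (Some d^!) ->
  gcut D1 g + gcut D2 g < gdeg a g + gdeg d g ->
  conn (norm g) (W D1 a * g) (W D2 d * g).
Proof.
move=> disj ad D1a D2d D1a' D2d' lt_cut.
have disj' o : ~~ (D2 o && D1 o) by rewrite andbC.
have da : d.1 != a.1 by rewrite eq_sym.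
case: (boolP (D1 (Some d^!))) => D1d'; last exact: conn_square.
case: (boolP (D2 (Some a^!))) => D2a'; last first.
  by apply/conn_sym/conn_square => //; rewrite addnC (addnC (gdeg d g)).
case: (ltnP (gcut D1 g) (gdeg d g)) => [lt1|ge1]; first exact: conn_linked.
by apply/conn_sym/conn_linked => //; move: lt_cut ge1; clear; lia.
Qed.

(** By submodularity the intersection or the union of the cuts shortens [g]; both are nested with
    [D1] and with [D2]. *)
Lemma conn_same_base D1 D2 a g :
  D1 (Some a) -> D2 (Some a) -> ~~ D1 (Some a^!) -> ~~ D2 (Some a^!) ->
  gcut D1 g + gcut D2 g < gdeg a g + gdeg a g ->
  conn (norm g) (W D1 a * g) (W D2 a * g).
Proof.
move=> D1a D2a D1a' D2a' lt_cut; have sub := gcut_submodular D1 D2 g.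
case: (ltnP (gcut (predI D1 D2) g) (gdeg a g)) => [lt1|ge1].
  apply: (@conn_step _ _ (W (predI D1 D2) a * g)).
  - by apply/edge_sym/edge_nested => //= [o /andP[]|] //; rewrite D1a.
  - by rewrite norm_wh_lt //= ?D1a // (negPf D1a').
  by apply/conn_edge/edge_nested => //= [o /andP[]|] //; rewrite D1a.
apply: (@conn_step _ _ (W (predU D1 D2) a * g)).
- by apply: edge_nested => //= [o ->|] //; rewrite negb_or D1a'.
- rewrite norm_wh_lt /= ?D1a // ?negb_or ?D1a' //.
  by move: lt_cut sub ge1; clear; lia.
apply/conn_edge/edge_sym/edge_nested => //= [o ->|] //; first by rewrite orbT.
by rewrite negb_or D1a'.
Qed.

(** The corner is nested in [A] and disjoint from the complement of [B], which describes the same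
    element as [B] with multiplier [b^!]. *)
Lemma conn_corner A B a b g : a.1 != b.1 ->
  A (Some a) -> ~~ A (Some a^!) -> B (Some b) -> ~~ B (Some b^!) -> B (Some a) ->
  gcut B g <= gdeg b g -> gcut (predI A B) g < gdeg a g ->
  conn (norm g) (W A a * g) (W B b * g).
Proof.
move=> ab Aa Aa' Bb Bb' Ba leB ltC.
apply: (@conn_step _ _ (W (predI A B) a * g)).
- by apply/edge_sym/edge_nested => //= [o /andP[]|] //; rewrite Aa.
- by rewrite norm_wh_lt //= ?Aa // (negPf Aa').
rewrite -(W_compl B); apply: conn_disjoint => //=.
- by move=> o; rewrite -andbA andbN andbF.
- by rewrite Aa.
- by rewrite (negPf Aa').
- by rewrite inv_letterK negbK.
by rewrite gcut_compl gdegV; move: leB ltC; clear; lia.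
Qed.

Lemma gcut_corner A B (A' B' : pred (option (letter n))) g : A =1 A' -> B =1 B' ->
  gcut (predI A B) g = gcut (predI A' B') g.
Proof. by move=> AA BB; apply: eq_gcut => o /=; rewrite AA BB. Qed.

Lemma gcut_corners A B g :
  (gcut (predI A B) g + gcut (predI (predC A) (predC B)) g <= gcut A g + gcut B g)%N.
Proof.
have -> : gcut (predI (predC A) (predC B)) g = gcut (predU A B) g.
  by rewrite -gcut_compl; apply: eq_gcut => o /=; rewrite negb_and !negbK.
exact: gcut_submodular.
Qed.

(* If some corner of the two cuts that contains [a], [a^!], [b] or [b^!] reduces the norm with that
   letter as multiplier, then [conn_corner] applies; otherwise submodularity of cuts at the two pairs
   of opposite corners contradicts the last hypothesis. *)
Lemma conn_distinct A B a b g : a.1 != b.1 ->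
  A (Some a) -> ~~ A (Some a^!) -> B (Some b) -> ~~ B (Some b^!) ->
  gcut A g <= gdeg a g -> gcut B g <= gdeg b g ->
  gcut A g + gcut B g < gdeg a g + gdeg b g ->
  conn (norm g) (W A a * g) (W B b * g).
Proof.
move=> ab Aa Aa' Bb Bb' leA leB lt_cut.
have ba : b.1 != a.1 by rewrite eq_sym.
have q1 := gcut_corners A B g; have := gcut_corners A (predC B) g.
rewrite gcut_compl (@gcut_corner (predC A) _ (predC A) B) //; last by move=> o /=; rewrite negbK.
move=> q2.
have Ca : gcut (predI A (if B (Some a) then B else predC B)) g < gdeg a g ->
    conn (norm g) (W A a * g) (W B b * g).
  case: ifP => Ba ltC; first exact: conn_corner.
  by rewrite -(W_compl B); apply: conn_corner; rewrite //= ?inv_letterK ?negbK ?Ba ?gcut_compl.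
have Ca' : gcut (predI (predC A) (if B (Some a^!) then B else predC B)) g < gdeg a g ->
    conn (norm g) (W A a * g) (W B b * g).
  rewrite -(W_compl A); case: ifP => Ba ltC.
    by apply: conn_corner; rewrite //= ?inv_letterK ?negbK.
  by rewrite -(W_compl B); apply: conn_corner; rewrite //= ?inv_letterK ?negbK ?Ba ?gcut_compl.
have predIC (P Q : pred (option (letter n))) : gcut (predI P Q) g = gcut (predI Q P) g.
  by apply: eq_gcut => o /=; rewrite andbC.
have Cb : gcut (predI (if A (Some b) then A else predC A) B) g < gdeg b g ->
    conn (norm g) (W A a * g) (W B b * g).
  rewrite predIC => ltC; apply: conn_sym; case: ifP ltC => Ab ltC; first exact: conn_corner.
  by rewrite -(W_compl A); apply: conn_corner; rewrite //= ?inv_letterK ?negbK ?Ab ?gcut_compl.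
have Cb' : gcut (predI (if A (Some b^!) then A else predC A) (predC B)) g < gdeg b g ->
    conn (norm g) (W A a * g) (W B b * g).
  rewrite predIC => ltC; apply: conn_sym; rewrite -(W_compl B); case: ifP ltC => Ab ltC.
    by apply: conn_corner; rewrite //= ?inv_letterK ?negbK.
  by rewrite -(W_compl A); apply: conn_corner; rewrite //= ?inv_letterK ?negbK ?Ab ?gcut_compl.
case: (ltnP _ _) Ca => [? /(_ isT)//|ga _]; case: (ltnP _ _) Ca' => [? /(_ isT)//|ga' _].
case: (ltnP _ _) Cb => [? /(_ isT)//|gb _]; case: (ltnP _ _) Cb' => [? /(_ isT)//|gb' _].
(* Either two opposite corners carry a letter of index [a.1] and one of index [b.1], and one of
   [q1], [q2] suffices, or one pair carries [a], [a^!] and the other [b], [b^!], and their sum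
   does. *)
exfalso; move: lt_cut q1 q2 ga ga' gb gb'.
case: (B (Some a)); case: (B (Some a^!)); case: (A (Some b)); case: (A (Some b^!)); clear; lia.
Qed.

Lemma conn_peak A B a b g :
  A (Some a) -> ~~ A (Some a^!) -> B (Some b) -> ~~ B (Some b^!) ->
  norm (W A a * g) <= norm g -> norm (W B b * g) < norm g ->
  conn (norm g) (W A a * g) (W B b * g).
Proof.
move=> Aa Aa' Bb Bb'; rewrite norm_wh_leq // norm_wh_lt // => leA ltB.
have lt_cut : gcut A g + gcut B g < gdeg a g + gdeg b g by move: leA ltB; clear; lia.
case: (eqVneq a.1 b.1) => [/same_index[ab|ab]|ab].
- by move: ab Aa Aa' leA lt_cut => -> *; apply: conn_same_base.
- move: ab Aa Aa' leA lt_cut => -> ; rewrite inv_letterK => *.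
  rewrite -(W_compl B); apply: conn_same_base => //=; rewrite ?inv_letterK ?negbK //.
  by rewrite gcut_compl.
by apply: conn_distinct => //; apply: ltnW.
Qed.

Lemma act_gen_neq1 g x : act g (fgen x) != 1.
Proof.
apply/negP => /eqP gx; have : fgen x = 1.
  by rewrite -[LHS]act1 -(mulVg g) actM gx (morph1_group (@actm _)).
by move/(congr1 (@fword n)).
Qed.

Lemma norm1 : norm 1 = n.
Proof.
rewrite /norm (eq_bigr (fun=> 1%N)) ?sum_nat_const ?card_ord ?muln1 // => i _.
by rewrite act1.
Qed.

Lemma norm_ge g : n <= norm g.
Proof.
rewrite -{1}(card_ord n) -sum1_card; apply: leq_sum => i _.
by rewrite lt0n size_fg_eq0 act_gen_neq1.
Qed.

(** At the identity the multiplier occurs once, and the cut already crosses a turn at its generator.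
    Hence every other letter lies on the side of the base point. *)
Lemma wh_trivial D a : D (Some a) -> ~~ D (Some a^!) -> norm (W D a) <= n -> W D a = 1.
Proof.
move=> Da Da'; rewrite -(mulg1 (W D a)) -norm1 norm_wh_leq //.
have -> : gdeg a 1 = 1%N.
  rewrite /gdeg (bigD1 a.1) //= big1 ?addn0 => [|i ia]; rewrite act1 /deg /= addn0 ?eqxx //.
  by rewrite (negPf ia).
rewrite /gcut (bigD1 a.1) //=; set c := cut _ _ _; set r := (\sum_(i < n | _) _)%N => le_cr.
have c1 : 0 < c.
  rewrite /c act1 /=; move: Da Da'; clear; case: a => i [] /= -> /negPf->;
    by case: (D None).
have {c1 le_cr} /eqP : r = 0%N by lia.
rewrite sum_nat_eq0 => /forallP r0.
have D0 x : x.1 != a.1 -> D (Some x) = D None.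
  move=> xa; have := implyP (r0 x.1) xa; rewrite act1 /= addn_eq0 !eqb0 !negbK.
  by case: x {xa} => i [] /= /andP[/eqP-> /eqP].
rewrite mulg1 /W /wh; case Dn: (D None); apply: phi0 => x xa; by rewrite D0 ?Dn.
Qed.

Inductive descends : G -> Prop :=
| descends_W w : descends (iW w)
| descends_edge g h of edge g h & norm h < norm g & descends h : descends g.

Lemma descends_iW w g : descends g -> descends (iW w * g).
Proof.
case=> [v|{}g h gh lt_hg dh]; first by rewrite -(stWM St); apply: descends_W.
apply: descends_edge dh; last by rewrite norm_iW.
exact/edge_sym/edge_iW/edge_sym.
Qed.

Lemma edge_from_W (v : wn n) h : edge (iW v) h -> norm h <= norm (iW v) -> exists w, h = iW w.
Proof.
case=> w [D [a [Da Da' ->]]]; rewrite -mulgA norm_iW.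
have /= := wh_conj St (w_inv v) D a; rewrite -/(W _ _) -iWV => H.
have {}H : W D a * iW v = iW v *
    W (fun o => D (omap (wl (w_inv (w_inv v))) o)) (wl (w_inv v) a).
  apply: (mulgI (iW v)^-1); apply: (mulIg (iW v)^-1).
  by rewrite /= mulKg -H !mulgA mulgK.
have vK x : wl (w_inv (w_inv v)) (wl (w_inv v) x) = x by rewrite wlVK.
rewrite H norm_iW -[X in _ <= norm X]mulg1 norm_iW norm1 => le_n.
rewrite wh_trivial //= -?wl_inv ?vK // mulg1 -(stWM St).
by exists (wmul w v).
Qed.

(** A rising edge is itself a first step of descent for [h]. Otherwise [h] and the first vertex [g1]
    on the descent of [g] form a peak at [g], and induction on the norm carries the property from
    [g1] along the path of [conn_peak]. *)
Lemma descends_closed g h : edge g h -> descends g -> descends h.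
Proof.
have [N] := ubnP (norm g); elim: N g h => // N IH g h; rewrite ltnS => le_gN gh dg.
case: (ltnP (norm g) (norm h)) => [lt_gh|le_hg]; first exact: descends_edge (edge_sym gh) lt_gh dg.
case: dg le_gN gh le_hg => [v|{}g g1 gg1 lt_g1 dg1] le_gN gh le_hg.
  by have [w ->] := edge_from_W gh le_hg; apply: descends_W.
(* The induction hypothesis is applied at every vertex but the last, which need not be below [g]. *)
have along (x y : G) : conn (norm g) x y -> norm x < norm g -> descends x -> descends y.
  elim=> [{}x {}y xy|{}x k {}y xk kN _ IHk] ltx dx.
    by apply: IH xy dx; apply: leq_trans ltx le_gN.
  by apply: IHk => //; apply: IH xk dx; apply: leq_trans ltx le_gN.
case: gh le_hg => w [A [a [Aa Aa' ->]]]; rewrite -mulgA norm_iW => leA.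
case: gg1 lt_g1 dg1 => v [B [b [Bb Bb' ->]]]; rewrite -mulgA norm_iW => ltB dB.
apply: descends_iW; apply: along (conn_sym (conn_peak Aa Aa' Bb Bb' leA ltB)) ltB _.
by have := descends_iW (w_inv v) dB; rewrite -iWV mulKg.
Qed.

Lemma edge_E x y g : x.1 != y.1 -> edge g (E x y * g).
Proof.
move=> xy; pose D (o : option (letter n)) := (o == Some y) || (o == Some x).
have -> : E x y = W D y.
  rewrite /W /wh /= -(phi_pred1 E xy); apply: eq_phi => z zy.
  by rewrite /D !someE (neq_of_index zy).
apply: edge_wh; first by rewrite /D eqxx.
by rewrite /D !someE inv_letter_neq /=; apply: contraNneq xy => <-.
Qed.

Lemma descends_faithful g : descends g -> (forall u, act g u = u) -> g = 1.
Proof.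
move=> dg gid; have ng : norm g = n.
  by rewrite -norm1; apply: eq_bigr => i _; rewrite gid act1.
case: dg gid ng => [w wid _|{}g h gh lt_hg _ _ ng]; last first.
  by have := norm_ge h; rewrite leqNgt -ng lt_hg.
rewrite -(stW1 St); congr iW; apply/wn_ext => x; rewrite wl1.
by have := wid (fgen x); rewrite (sa_W Sa) => /(congr1 (@fword n)) [].
Qed.

End Peaks.

(** * Nielsen reduction *)

Section CommonPrefix.
Variable T : eqType.
Implicit Types s t u : seq T.

Fixpoint lcp s t : nat :=
  match s, t with
  | x :: s', y :: t' => if x == y then (lcp s' t').+1 else 0
  | _, _ => 0
  end.

Lemma lcpC s t : lcp s t = lcp t s.
Proof. by elim: s t => [|x s IH] [|y t] //=; rewrite eq_sym IH. Qed.

Lemma lcpss s : lcp s s = size s.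
Proof. by elim: s => //= x s ->; rewrite eqxx. Qed.

Lemma lcp_take s t m : m <= lcp s t -> take m s = take m t.
Proof.
elim: m s t => [|m IH] [|x s] [|y t] //=; case: eqP => // -> lt_m.
by rewrite (IH _ t).
Qed.

(** Common prefixes are ultrametric. *)
Lemma lcp_lt s t u : lcp s t < lcp t u -> lcp s u = lcp s t.
Proof.
elim: s t u => [|x s IH] [|y t] [|z u] //=.
case: (eqVneq y z) => [->|yz]; last by case: ifP.
by case: (eqVneq x z) => // _; rewrite ltnS => /IH->.
Qed.

End CommonPrefix.

Section NielsenWords.
Variable n : nat.
Implicit Types (x y z : letter n) (u v w : fgroup n).

Lemma size_reduce_lcp (s t : seq (letter n)) : reduced s -> reduced t ->
  (size (reduce (word_inv s ++ t)) + 2 * lcp s t = size s + size t)%N.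
Proof.
elim: s t => [|x s IH] [|y t] rs rt.
- by [].
- by rewrite reduce_id //= muln0 addn0.
- by rewrite cats0 reduce_id ?reduced_word_inv // size_word_inv /= muln0.
rewrite word_inv_cons -catA /=; case: (eqVneq x y) => [xy|xy].
  subst y; rewrite -reduce_catr !reduce_cons -{2}(inv_letterK x) push_inv ?reduced_reduce //.
  rewrite reduce_catr; have := IH t (reduced_tail rs) (reduced_tail rt).
  by clear; lia.
rewrite reduce_id ?size_cat ?size_word_inv /=; first by clear; lia.
rewrite /reduced sorted_cat_cons -cats1 -word_inv_cons; apply/andP; split.
  exact: reduced_word_inv.
by rewrite /= inv_letterK eq_sym xy.
Qed.

Lemma size_fgVM u v : (size ((u^-1 * v)%g : fgroup n) + 2 * lcp u v = size u + size v)%N.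
Proof. by rewrite fwordM fwordV size_reduce_lcp ?fwordP. Qed.

Lemma size_fgM_lcp u v : (size ((u * v)%g : fgroup n) + 2 * lcp (u^-1)%g v = size u + size v)%N.
Proof. by have := size_fgVM u^-1 v; rewrite invgK size_fgV. Qed.

(** Otherwise the middle of the word would contain a letter equal to its own inverse (odd length) or
    two adjacent letters that cancel (even length). *)
Lemma lcp_self_inv u : u != 1 -> (2 * lcp (u^-1)%g u < size u)%N.
Proof.
rewrite -size_fg_eq0 -lt0n fwordV => u_gt0; rewrite ltnNge; apply/negP => le_c.
have [x0 _] : exists x0 : letter n, x0 \in fword u.
  by case: (fword u) u_gt0 => // x s _; exists x; rewrite mem_head.
pose i := ((size u).-1 %/ 2)%N; have lt_i : i < lcp (word_inv u) u.
  rewrite /i; move: u_gt0 le_c; set m := size u; set c := lcp _ _.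
  by clearbody m c; clear; lia.
have : nth x0 (word_inv u) i = nth x0 u i.
  by rewrite -(nth_take x0 lt_i) (lcp_take (leqnn _)) nth_take.
have lt_iu : i < size u by rewrite /i; lia.
rewrite nth_rev size_map //; rewrite (nth_map x0); last by rewrite /i; lia.
have [->|Ei] : (size u - i.+1 = i \/ size u - i.+1 = i.+1)%N by rewrite /i; lia.
  by move/eqP; rewrite inv_letter_neq.
rewrite Ei; have lt : i.+1 < size u by move: Ei lt_iu; clear; lia.
have /(sortedP x0)/(_ i lt) := fwordP u.
by move=> /negP H E; apply: H; rewrite -E inv_letterK.
Qed.


Definition letter_count := #|{: letter n}|.
Let K := letter_count.

(* Comparing codes of words of equal length is comparing them lexicographically. It breaks ties
   between bases of equal total length in Nielsen's algorithm. *)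
Definition code (s : seq (letter n)) : nat := foldl (fun c x => c * K + enum_rank x)%N 0 s.

Lemma code_cat s t : code (s ++ t) = (code s * K ^ size t + code t)%N.
Proof.
rewrite /code foldl_cat; move: (foldl _ 0 s) => c.
elim/last_ind: t => [|t x IH]; first by rewrite /= expn0 muln1 addn0.
by rewrite !foldl_rcons IH size_rcons expnS mulnDl addnA -mulnA (mulnC K).
Qed.

Lemma code_lt s : code s < K ^ size s.
Proof.
rewrite /code; elim/last_ind: s => [|s x IH] //; rewrite foldl_rcons size_rcons expnS.
have := ltn_ord (enum_rank x); rewrite -/K => xK.
apply: (@leq_trans ((foldl (fun c y => c * K + enum_rank y)%N 0 s).+1 * K)).
  by rewrite mulSn addnC ltn_add2r.
by rewrite mulnC leq_mul2l IH orbT.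
Qed.

Lemma code_inj s t : size s = size t -> code s = code t -> s = t.
Proof.
elim/last_ind: s t => [|s x IH] t; first by move/esym/size0nil->.
case/lastP: t => [|t y]; rewrite !size_rcons //= => -[st].
rewrite /code !foldl_rcons -!/(code _) => E.
have K0 : 0 < K by apply/card_gt0P; exists x.
have xy : enum_rank x = enum_rank y.
  apply: val_inj; have /= := congr1 (modn^~ K) E.
  by rewrite !modnMDl !modn_small.
rewrite (enum_rank_inj xy); congr rcons; apply: IH => //.
have := congr1 (divn^~ K) E; rewrite /= !divnMDl // !divn_small //.
by rewrite !addn0.
Qed.

Lemma size_reduce_id (s : seq (letter n)) : size (reduce s) = size s -> reduce s = s.
Proof.
elim: s => // x s IH; rewrite reduce_cons; have := size_reduce s.
case E: (reduce s) IH => [|y t] IH /=; first by case: s E IH => // y s E IH _ /= [] /IH.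
by case: ifP => _ /= le; [move: le; clear; lia | move=> [/IH->]].
Qed.

Lemma word_inv_cat (s t : seq (letter n)) : word_inv (s ++ t) = word_inv t ++ word_inv s.
Proof. by rewrite /word_inv map_cat rev_cat. Qed.

End NielsenWords.

Section NielsenReduction.
Variables (n : nat) (G : groupType) (iW : wn n -> G) (E : letter n -> letter n -> G).
Variable act : G -> fgroup n -> fgroup n.
Hypothesis St : steinberg iW E.
Hypothesis Sa : steinberg_action iW E act.
Variables f f' : fgroup n -> fgroup n.
Hypothesis fM : {morph f : u v / u * v}.
Hypothesis f'M : {morph f' : u v / u * v}.
Hypothesis fK : cancel f f'.
Hypothesis f'K : cancel f' f.
Implicit Types (g : G) (x y z : letter n) (u v : fgroup n).

(** Right multiplication of [g] by a transvection is an elementary Nielsen move on these words. *)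
Definition basis g x := f (act g (fgen x)).
Local Notation U := basis.
Let K := letter_count n.

Lemma basisV g x : U g x^! = (U g x)^-1.
Proof. by rewrite /basis fgenV !morphV_group //; apply: (sa_morph Sa). Qed.

Lemma basis_E g x y : x.1 != y.1 -> U (g * E x y) x = U g x * U g y.
Proof. by move=> xy; rewrite /basis (sa_actM Sa) (sa_E Sa) // (sa_morph Sa) fM. Qed.

Lemma basis_E_out g x y z : x.1 != y.1 -> z.1 != x.1 -> U (g * E x y) z = U g z.
Proof. by move=> xy zx; rewrite /basis (sa_actM Sa) (sa_E_out Sa). Qed.

Lemma basis_neq1 g x : U g x != 1.
Proof.
apply: contra_neq (act_gen_neq1 Sa g x) => gx1.
by rewrite -[LHS]fK -/(basis g x) gx1 (morph1_group f'M).
Qed.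

(** Summing over both signs lets [code] compare the beginnings of the words and of their
    inverses. *)
Definition total (m : fgroup n -> nat) g : nat := \sum_x m (U g x).

Lemma total_E m g x y : x.1 != y.1 ->
  (total m (g * E x y)%g + (m (U g x) + m (U g x)^-1%g) =
   total m g + (m (U g x * U g y)%g + m (U g x * U g y)^-1%g))%N.
Proof.
move=> xy; pose rest h : nat := \sum_(z | z.1 != x.1) m (U h z).
have split_x h : total m h = (m (U h x) + (m (U h x)^-1%g + rest h))%N.
  rewrite /total (bigD1 x) // (bigD1 x^!) ?inv_letter_neq //= basisV; congr (_ + (_ + _))%N.
  by apply: eq_bigl => z; rewrite neq_index_letter.
have restE : rest (g * E x y) = rest g.
  by apply: eq_bigr => z zx; rewrite basis_E_out.
by rewrite !split_x basis_E // restE; clear; lia.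
Qed.

Local Notation len := (total (fun v => size v)).
Local Notation wt := (total (fun v => code v)).

Definition improves g x y := (x.1 != y.1) &&
  ((len (g * E x y) < len g) || (len (g * E x y) == len g) && (wt (g * E x y) < wt g)).

(** Nested induction, since the weight may grow when the length drops. *)
Lemma exists_unimprovable : exists g, forall x y, ~~ improves g x y.
Proof.
suff H : forall N M g, len g < N -> wt g < M -> exists g', forall x y, ~~ improves g' x y.
  by apply: (H (len 1).+1 (wt 1).+1 1); apply: leqnn.
elim=> // N IHN; elim=> // M IHM g lenN wtM.
case: (boolP [exists x, exists y, improves g x y]); last first.
  move=> no; exists g => x y; apply: contra no => imp.
  by apply/existsP; exists x; apply/existsP; exists y.
case/existsP=> x /existsP[y /andP[_ /orP[lt|/andP[/eqP eq lt]]]].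
  by apply: (IHN (wt (g * E x y)).+1 (g * E x y)); rewrite ?leqnn //; apply: leq_trans lt _.
by apply: (IHM (g * E x y)); rewrite ?eq //; apply: leq_trans lt _.
Qed.

Section Unimprovable.
Variable g : G.
Hypothesis min_g : forall x y, ~~ improves g x y.
Local Notation u := (basis g).
Local Notation c x y := (lcp (u x)^-1%g (u y)).

Let cC x y : c y^! x^! = c x y.
Proof. by rewrite !basisV invgK lcpC. Qed.

Let size_inv x : size (u x^!) = size (u x).
Proof. by rewrite basisV size_fgV. Qed.

Let size_gt0 x : 0 < size (u x).
Proof. by rewrite lt0n size_fg_eq0 basis_neq1. Qed.

Let len_E x y : x.1 != y.1 ->
  (len (g * E x y)%g + 2 * size (u x) = len g + 2 * size (u x * u y)%g)%N.
Proof.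
move=> xy; have := @total_E (fun v => size v) g x y xy; cbv beta.
by rewrite !size_fgV; clear; lia.
Qed.

Let le_half x y : x.1 != y.1 -> 2 * c x y <= size (u y).
Proof.
move=> xy; have := min_g x y; rewrite /improves xy negb_or -leqNgt => /andP[le_len _].
have := len_E xy; have := size_fgM_lcp (u x) (u y).
by move: le_len; clear; lia.
Qed.

Let le_half' x y : x.1 != y.1 -> 2 * c x y <= size (u x).
Proof. by move=> xy; rewrite -cC -size_inv; apply: le_half; rewrite eq_sym. Qed.

(** With [u y = P Q] and [(u x)^-1 = P R], the move keeps the length and replaces [P R] by [Q^-1 R];
    minimality of the weight therefore compares [P] with the inverse of [Q]. *)
Let code_half x y : x.1 != y.1 -> (2 * c x y = size (u y))%N ->
  code (take (c x y) (u y)) <= code (take (c x y) (u y)^-1).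
Proof.
move=> xy half; set m := c x y.
pose P := take m (u y); pose Q := drop m (u y); pose R := drop m (u x)^-1.
have sP : size P = m by rewrite size_take; case: ltnP => //; move: half; rewrite -/m; clear; lia.
have sQ : size Q = m by rewrite size_drop; move: half; rewrite -/m; clear; lia.
have uy : fword (u y) = P ++ Q by rewrite cat_take_drop.
have uxV : fword (u x)^-1 = P ++ R.
  by rewrite /P -(lcp_take (leqnn m)) cat_take_drop.
have ux : fword (u x) = word_inv R ++ word_inv P.
  by rewrite -word_inv_cat -uxV -fwordV invgK.
have sR : (size R + m)%N = size (u x).
  by rewrite ux size_cat !size_word_inv sP.
have uxuy : u x * u y = fg_of (word_inv R ++ Q).
  rewrite -(fg_ofP (u x)) -(fg_ofP (u y)) ux uy !fg_of_cat fg_of_inv.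
  by rewrite (fg_of_inv P) -!mulgA mulKg.
have sM := size_fgM_lcp (u x) (u y); rewrite half in sM.
have {}sM : size (u x * u y) = size (u x) by move: sM; clear; lia.
have word_M : fword (u x * u y) = word_inv R ++ Q.
  rewrite uxuy; apply: size_reduce_id; rewrite -[reduce _]/(fword (fg_of _)) -uxuy sM -sR.
  by rewrite size_cat size_word_inv sQ.
have word_MV : fword (u x * u y)^-1 = word_inv Q ++ R.
  by rewrite fwordV word_M word_inv_cat word_invK.
have take_V : take m (u y)^-1 = word_inv Q.
  by rewrite fwordV uy word_inv_cat take_size_cat // size_word_inv.
rewrite take_V -/P leqNgt; apply/negP => lt_QP.
have := min_g x y; rewrite /improves xy negb_or => /andP[_].
have -> : len (g * E x y) = len g by have := len_E xy; rewrite sM; clear; lia.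
rewrite eqxx /= -leqNgt => le_wt.
have := @total_E (fun v => code v) g x y xy; cbv beta.
rewrite word_M word_MV uxV ux !code_cat !size_word_inv sQ sP => wtE.
(* The new tail [Q] costs less than [K ^ size R], as [R] is at least as long as [Q]; a smaller
   leading half saves at least that much. *)
have Qlt : code Q < K ^ size R.
  apply: leq_trans (code_lt Q) _; rewrite leq_pexp2l //; first by apply/card_gt0P; exists x.
  by have := le_half' xy; rewrite -/m sQ; move: sR; clear; lia.
have : code (word_inv Q) * K ^ size R + K ^ size R <= code P * K ^ size R.
  by rewrite addnC -mulSn leq_mul2r lt_QP orbT.
by move: Qlt le_wt wtE; clear; rewrite -/K; lia.
Qed.

Let cancel_same x y : y != x^! -> x.1 = y.1 ->
  2 * c x y < size (u x) /\ 2 * c x y < size (u y).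
Proof.
move=> yx /same_index[xy|xy]; last by rewrite xy inv_letterK eqxx in yx.
by rewrite xy; split; apply/lcp_self_inv/basis_neq1.
Qed.

Let cancel_half x y : y != x^! -> 2 * c x y <= size (u x) /\ 2 * c x y <= size (u y).
Proof.
move=> yx; case: (eqVneq x.1 y.1) => [xy|xy].
  by have [lt1 lt2] := cancel_same yx xy; split; apply: ltnW.
by split; [apply: le_half' | apply: le_half].
Qed.

Let cancel_ltl x y : y != x^! -> c x y < size (u x).
Proof. by case/cancel_half => le1 _; have := size_gt0 x; move: le1; clear; lia. Qed.

(** If [u y] were consumed, each neighbour would cancel exactly half of it. Then [code_half] from
    both sides makes the first half of [u y] the inverse of the second, so [u y] would be
    trivial. *)
Let cancel_lt x y z : y != x^! -> z != y^! -> c x y + c y z < size (u y).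
Proof.
move=> yx zy; rewrite ltnNge; apply/negP => le_sum.
have [_ le_xy] := cancel_half yx; have [le_yz _] := cancel_half zy.
have xy : x.1 != y.1.
  by apply/eqP => /(cancel_same yx)[_]; move: le_yz le_sum; clear; lia.
have yz : y.1 != z.1.
  by apply/eqP => /(cancel_same zy)[+ _]; move: le_xy le_sum; clear; lia.
have half1 : (2 * c x y = size (u y))%N by move: le_xy le_yz le_sum; clear; lia.
have half2 : (2 * c y z = size (u y))%N by move: le_xy le_yz le_sum; clear; lia.
have half2' : (2 * c z^! y^! = size (u y^!))%N by rewrite cC size_inv.
have zy1 : (z^!).1 != (y^!).1 by rewrite eq_sym.
have le1 := code_half xy half1; have := code_half zy1 half2'.
rewrite cC basisV invgK => le2.
have cc : c x y = c y z by move: half1 half2; clear; lia.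
rewrite -cc in le2; set m := c x y in le1 le2 half1.
have sz (v : fgroup n) : size v = size (u y) -> size (take m v) = m.
  by move=> sv; rewrite size_take sv; case: ltnP => //; move: half1; clear; lia.
have PQ : take m (u y) = take m (u y)^-1.
  apply: code_inj; first by rewrite !sz ?size_fgV.
  by apply/eqP; rewrite eqn_leq le1.
have : fword (u y) = [::].
  rewrite -[LHS](reduce_id (fwordP _)) -(cat_take_drop m (u y)) PQ fwordV.
  have -> : take m (word_inv (u y)) = word_inv (drop m (u y)).
    rewrite -{1}(cat_take_drop m (u y)) word_inv_cat take_size_cat // size_word_inv size_drop.
    by move: half1; clear; lia.
  exact: reduce_word_invl.
by move=> uy0; have := size_gt0 y; rewrite uy0.
Qed.

Let basis_prod (s : seq (letter n)) : f (act g (fg_of s)) = \prod_(x <- s) u x.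
Proof.
elim: s => [|x s IH].
  by rewrite fg_of_nil (morph1_group (sa_morph Sa g)) (morph1_group fM) big_nil.
by rewrite big_cons -cat1s fg_of_cat (sa_morph Sa) fM IH.
Qed.

Let tail_cancel y (s : seq (letter n)) := if s is z :: _ then c y z else 0.

(** Induction from the last factor: the part of [u y] not cancelled by the next factor survives as a
    prefix, and every further factor keeps at least one letter by [cancel_lt]. *)
Lemma size_basis_prod y (s : seq (letter n)) : reduced (y :: s) ->
  lcp (\prod_(x <- y :: s) u x) (u y) = (size (u y) - tail_cancel y s)%N /\
  size s + (size (u y) - tail_cancel y s) <= size (\prod_(x <- y :: s) u x).
Proof.
elim: s y => [|z s IH] y; first by rewrite big_seq1 /= lcpss subn0.
move=> /= /andP[zy red]; have [] := IH z red.
rewrite ![\prod_(x <- y :: _) _]big_cons; set V := \prod_(x <- z :: s) u x => lcpV sizeV.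
have tail_lt : c y z + tail_cancel z s < size (u z).
  rewrite /tail_cancel; case: (s) red => [|z' t] /=.
    by rewrite addn0 -cC -size_inv => _; apply: cancel_ltl; rewrite inv_letterK eq_sym.
  by move=> /andP[z'z _]; apply: cancel_lt.
(* [V] agrees with [u z] beyond the part that [u y] cancels, so [u y] cancels the same amount
   against [V]. *)
have cV : lcp (u y)^-1 V = c y z.
  by apply: lcp_lt; rewrite [X in _ < X]lcpC lcpV; move: tail_lt; clear; lia.
have sM := size_fgM_lcp (u y) V; rewrite cV in sM.
(* The common prefix of [u y * V] and [u y] is computed from the length of [V]. *)
have := size_fgVM (u y * V) (u y).
have -> : (u y * V)^-1 * u y = V^-1 by rewrite invgM mulgVK.
rewrite size_fgV => sL; split; first by move: sM sL tail_lt sizeV; clear; rewrite /=; lia.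
by move: sM sL tail_lt sizeV; clear; rewrite /=; lia.
Qed.

(** A reduced preimage of two or more letters would have an image of length at least two. *)
Lemma basis_covers z : exists x, u x = fgen z.
Proof.
pose v := act g^-1 (f' (fgen z)).
have fv : f (act g v) = fgen z by rewrite /v -(sa_actM Sa) mulgV (sa_act1 Sa) f'K.
rewrite -(fg_ofP v) basis_prod in fv; move: (fwordP v) fv.
case: (fword v) => [|x s] red; first by rewrite big_nil => /(congr1 (@fword n)).
move=> fv; have [_] := size_basis_prod red; rewrite fv fword_gen.
case: s red fv => [|y s] red fv; first by exists x; rewrite -fv big_seq1.
rewrite (_ : tail_cancel x (y :: s) = c x y) // => le1; exfalso.
have : c x y < size (u x).
  by apply: cancel_ltl; case/andP: red.
by move: le1; clear; rewrite [size (y :: s)]/= [size [:: z]]/=; lia.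
Qed.

Lemma unimprovable_signed_perm : exists w, forall v, f (act (g * iW w) v) = v.
Proof.
(* The default is never taken, by [basis_covers]. *)
pose pre i := if [pick x | u x == fgen (i, false)] is Some x then x else (i, false).
have preE i : u (pre i) = fgen (i, false).
  rewrite /pre; case: pickP => [x /eqP //|no].
  by have [x ux] := basis_covers (i, false); have := no x; rewrite ux eqxx.
have [|||w E1] := @wn_trans n (enum 'I_n) (map pre (enum 'I_n)).
- exact: enum_uniq.
- rewrite -map_comp map_inj_uniq ?enum_uniq // => i j /= /same_index[ij|ij].
    by have := preE i; rewrite ij preE => /(congr1 (@fword n)) [].
  by have := preE i; rewrite ij basisV preE -fgenV => /(congr1 (@fword n)).
- by rewrite [RHS]size_map.
have wE i : wl w (i, false) = pre i.
  have := congr1 (fun s => nth (pre i) s i) E1.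
  by cbv beta; rewrite (nth_map i) ?size_enum_ord // (nth_map i) ?size_enum_ord // nth_ord_enum.
exists w; apply: eq_fg_morph => [a b|a b|i] //; first by rewrite (sa_morph Sa) fM.
by rewrite (sa_actM Sa) (sa_W Sa) wE -/(basis _ _) preE.
Qed.



End Unimprovable.

Lemma act_surjective : exists g, forall v, f v = act g v.
Proof.
have [g min_g] := exists_unimprovable; have [w gw] := unimprovable_signed_perm min_g.
exists (g * iW w)^-1 => v; rewrite -[in LHS](sa_act1 Sa v) -(mulgV (g * iW w)).
by rewrite (sa_actM Sa) gw.
Qed.

End NielsenReduction.

(** * The presented group *)

Section Endomorphisms.
Variable n : nat.
Implicit Types (f g : endo n) (x : letter n) (u v : fgroup n).

Definition endo_letter f x : fgroup n := if x.2 then (fg_of (f x.1))^-1 else fg_of (f x.1).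
Definition fext f : fgroup n -> fgroup n := fg_lift (endo_letter f).

Lemma endo_letterV f x : endo_letter f x^! = (endo_letter f x)^-1.
Proof. by rewrite /endo_letter /=; case: x.2; rewrite ?invgK. Qed.

Lemma fextM f : {morph fext f : u v / u * v}.
Proof. exact/fg_liftM/endo_letterV. Qed.

Lemma fext_gen f i : fext f (fgen (i, false)) = fg_of (f i).
Proof. by rewrite /fext fg_lift_gen. Qed.

Lemma fg_of_apply f s : fg_of (apply_endo f s) = fext f (fg_of s).
Proof.
rewrite /apply_endo fg_of_reduce /fext fg_lift_of; last exact: endo_letterV.
elim: s => [|x s IH]; first by rewrite big_nil.
rewrite /= fg_of_cat IH big_cons; congr (_ * _).
by rewrite /endo_letter; case: x.2; rewrite ?fg_of_inv.
Qed.

Lemma fext_comp f g u : fext (Defs.comp f g) u = fext f (fext g u).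
Proof.
move: u; apply: eq_fg_morph => [u v|u v|i]; first exact: fextM.
  by rewrite !fextM.
by rewrite !fext_gen fg_of_apply.
Qed.

Lemma fext_id u : fext (@id_endo n) u = u.
Proof. by move: u; apply: eq_fg_morph => // [u v|i]; [apply: fextM | rewrite fext_gen]. Qed.

Lemma feqP f g : feq f g <-> fext f =1 fext g.
Proof.
split=> [fg|fg i].
  apply: eq_fg_morph => [u v|u v|i]; try exact: fextM.
  by rewrite !fext_gen; apply: val_inj; apply: fg.
by have := fg (fgen (i, false)); rewrite !fext_gen => /(congr1 (@fword n)).
Qed.

Lemma fext_w w x : fext (w_endo w) (fgen x) = fgen (wl w x).
Proof.
case: x => i [|]; last by rewrite fext_gen wl_pairE /= addbF.
rewrite -[(i, true)]/((i, false)^!) fgenV (morphV_group (@fextM _)) fext_gen wl_inv fgenV.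
by rewrite wl_pairE /= addbF.
Qed.

Lemma fext_gword (r s : gword n) u :
  fext (eval_word (r ++ s)) u = fext (eval_word r) (fext (eval_word s) u).
Proof.
elim: r => [|x r IH] /=; first by rewrite fext_id.
by rewrite !fext_comp IH.
Qed.

End Endomorphisms.

(** * The relators hold in the automorphism group *)

Section Soundness.
Variables (n : nat) (hn : 3 < n).
Let A1 : letter n := (i1 hn, false).
Let A2 : letter n := (i2 hn, false).

Lemma eta1 : fext (@eta_endo n) (fgen A1) = (fgen A2)^-1 * fgen A1.
Proof.
rewrite fext_gen /eta_endo /= -cat1s fg_of_cat -fgenV; congr (fgen (_, _) * _).
by apply: val_inj; rewrite val_insubd /= ltnW // ltnW.
Qed.

Lemma eta2 : fext (@eta_endo n) (fgen A2) = (fgen A2)^-1.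
Proof. by rewrite fext_gen -fgenV. Qed.

Lemma eta1V : fext (@eta_endo n) (fgen A1^!) = (fgen A1)^-1 * fgen A2.
Proof. by rewrite fgenV (morphV_group (@fextM _ _)) eta1 invgM invgK. Qed.

Lemma eta2V : fext (@eta_endo n) (fgen A2^!) = fgen A2.
Proof. by rewrite fgenV (morphV_group (@fextM _ _)) eta2 invgK. Qed.

Lemma eta_out x : x.1 != i1 hn -> x.1 != i2 hn -> fext (@eta_endo n) (fgen x) = fgen x.
Proof.
have out i : i != i1 hn -> i != i2 hn ->
    fext (@eta_endo n) (fgen (i, false)) = fgen (i, false).
  by move=> ni1 ni2; rewrite fext_gen /eta_endo; case: i ni1 ni2 => -[|[|m]].
case: x => i [|] xi1 xi2; last exact: out.
by rewrite -[(i, true)]/((i, false)^!) !fgenV (morphV_group (@fextM _ _)) out.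
Qed.

(* Words in [eta] and in the signed permutations of the first four generators act on numbered
   letters, so that a relator involving them can be evaluated by computation. *)
Inductive code_gen := CEta | CSwap of nat & nat | CTau of nat.

Definition index_of k : 'I_n := nth (i1 hn) [:: i1 hn; i2 hn; i3 hn; i4 hn] k.
Let num (x : nat * bool) : letter n := (index_of x.1, x.2).

Definition code_valid c :=
  match c with CEta => true | CSwap i j => (i < 4) && (j < 4) | CTau i => i < 4 end.

Definition decode c : gen n * bool :=
  match c with
  | CEta => @gE n
  | CSwap i j => gW (sigma (index_of i) (index_of j))
  | CTau i => gW (tau (index_of i))
  end.

Definition code_act c (x : nat * bool) : seq (nat * bool) :=
  match c with
  | CEta => if x.1 == 0 then (if x.2 then [:: x; (1%N, false)] else [:: (1%N, true); x])
            else if x.1 == 1%N then [:: (1%N, ~~ x.2)] else [:: x]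
  | CSwap i j => [:: (if x.1 == i then j else if x.1 == j then i else x.1, x.2)]
  | CTau i => [:: (x.1, (x.1 == i) (+) x.2)]
  end.

Definition code_run cs s := foldr (fun c s => flatten (map (code_act c) s)) s cs.

Definition code_reduce (s : seq (nat * bool)) := foldr (fun x w =>
  if w is y :: w' then if y == (x.1, ~~ x.2) then w' else x :: w else [:: x]) [::] s.

Let val_index k : k < 4 -> val (index_of k) = k.
Proof. by case: k => [|[|[|[|]]]]. Qed.

Let eq_index j k : j < 4 -> k < 4 -> (index_of j == index_of k) = (j == k).
Proof. by move=> j4 k4; rewrite -val_eqE !val_index. Qed.

Let code_actE c x : code_valid c -> x.1 < 4 ->
  fext (eval_gen (decode c)) (fgen (num x)) = fg_of (map num (code_act c x)) /\
  all (fun y => y.1 < 4) (code_act c x).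
Proof.
case: c x => [|i j|i] [k b] /= cv k4.
- case: k k4 => [|[|k]] k4.
  + have -> : num (0, b) = if b then A1^! else A1 by case: b.
    by case: b; rewrite ?eta1V ?eta1; split=> //; rewrite -fgenV -fg_of_cat.
  + have -> : num (1%N, b) = if b then A2^! else A2 by case: b.
    by case: b; rewrite ?eta2V ?eta2 -?fgenV.
  rewrite /= andbT k4; split=> //; apply: eta_out => /=; rewrite -val_eqE val_index //.
- move: cv => /andP[i4 j4]; rewrite fext_w wl_sigma /= !eq_index //.
  by case: (k == i); case: (k == j); rewrite andbT.
by rewrite fext_w wl_tau /= eq_index // andbT.
Qed.

Let code_runE cs s : all code_valid cs -> all (fun y => y.1 < 4) s ->
  fext (eval_word (map decode cs)) (fg_of (map num s)) = fg_of (map num (code_run cs s)) /\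
  all (fun y => y.1 < 4) (code_run cs s).
Proof.
move=> + s4; elim: cs => [|c cs IH] /=; first by rewrite fext_id.
case/andP=> cv /IH[{}IH]; rewrite fext_comp IH.
elim: (code_run cs s) => [|x t IHt] /= => [_|/andP[x4 /IHt[IH1 IH2]]].
  by rewrite fg_of_nil (morph1_group (@fextM _ _)).
have [x1 x2] := code_actE cv x4.
have -> : fg_of (num x :: map num t) = fgen (num x) * fg_of (map num t) by rewrite -fg_of_cat.
by rewrite fextM IH1 map_cat fg_of_cat all_cat x2 IH2 x1.
Qed.

Let code_reduceE s : fg_of (map num (code_reduce s)) = fg_of (map num s).
Proof.
have consE (y : nat * bool) w : fg_of (map num (y :: w)) = fgen (num y) * fg_of (map num w).
  by rewrite -fg_of_cat.
elim: s => // x s IH; rewrite consE -IH /= -/(code_reduce s).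
case: (code_reduce s) => [|y w]; first by rewrite mulg1.
case: eqP => [->|_]; last by rewrite consE.
by rewrite consE -[num (_, ~~ _)]/((num x)^!) fgenV mulVKg.
Qed.

Definition code_check cs := all code_valid cs &&
  all (fun k => code_reduce (code_run cs [:: (k, false)]) == [:: (k, false)]) (iota 0 4).

Lemma code_checkP cs u : code_check cs -> fext (eval_word (map decode cs)) u = u.
Proof.
case/andP=> cv /allP chk; move: u; apply: eq_fg_morph => [u v|//|i]; first exact: fextM.
case: (ltnP i 4) => [i4|i4].
  have -> : fgen (i, false) = fg_of (map num [:: (val i, false)]).
    by congr (fgen (_, _)); apply: val_inj; rewrite val_index.
  have [||-> _] := @code_runE cs [:: (val i, false)] => //=; first by rewrite i4.
  by rewrite -code_reduceE (eqP (chk (val i) _)) ?mem_iota.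
(* Generators beyond the fourth are fixed by every coded step. *)
elim: cs cv {chk} => [_|c cs IH] /=; first by rewrite fext_id.
case/andP=> cv /IH{}IH; rewrite fext_comp IH.
have out k : k < 4 -> (i == index_of k) = false.
  by move=> k4; apply/negP => /eqP ik; rewrite ik val_index // leqNgt k4 in i4.
case: c cv => [|j k|j] /= cv.
- by apply: eta_out; rewrite /= ?(out 0) ?(out 1%N).
- by case/andP: cv => j4 k4; rewrite fext_w wl_sigma /= !out.
by rewrite fext_w wl_tau /= out.
Qed.

Lemma eta_sq u : fext (@eta_endo n) (fext (@eta_endo n) u) = u.
Proof. by have := @code_checkP [:: CEta; CEta] u isT; rewrite /= !fext_comp fext_id. Qed.

(** The relators with [tau i] and [sigma i j] have arbitrary indices and escape evaluation on four
    generators; they follow from this commutation. *)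
Lemma eta_commute (w : wn n) u : wl w A1 = A1 -> wl w A2 = A2 ->
  fext (@eta_endo n) (fext (w_endo w) u) = fext (w_endo w) (fext (@eta_endo n) u).
Proof.
move=> w1 w2; move: u; apply: eq_fg_morph => [u v|u v|i]; rewrite ?fextM //.
rewrite fext_w; case: (eqVneq i (i1 hn)) => [->|ni1].
  rewrite w1 eta1 fextM (morphV_group (@fextM _ _)) !fext_w w1 w2.
  by [].
case: (eqVneq i (i2 hn)) => [->|ni2].
  by rewrite w2 eta2 (morphV_group (@fextM _ _)) fext_w w2.
have w1i : (wl w A1).1 = i1 hn by rewrite w1.
have w2i : (wl w A2).1 = i2 hn by rewrite w2.
by rewrite !eta_out ?fext_w // ?eta_out // -?w1i -?w2i ?wl_fst.
Qed.

Lemma relator_sound r u : is_relator hn r -> fext (eval_word r) u = u.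
Proof.
have sq (w : wn n) : wl w A1 = A1 -> wl w A2 = A2 -> (forall x, wl w (wl w x) = x) ->
    fext (eval_word (wpow [:: @gE n; gW w] 2)) u = u.
  move=> w1 w2 ww; rewrite /= !fext_comp fext_id -!eta_commute // eta_sq.
  move: u; apply: eq_fg_morph => // [u v|i]; first by rewrite !fextM.
  by rewrite !fext_w ww.
case=> [->|]; first exact: (@code_checkP [:: CEta; CEta]).
case=> [->|].
  exact: (@code_checkP (flatten (nseq 3 [:: CSwap 0 1%N; CEta]))).
case=> [[i [i2 ->]]|].
  apply: sq => [||x]; rewrite ?wl_tau /=.
  - by rewrite (_ : (i1 hn == i) = false) //; apply/negbTE; rewrite -val_eqE; case: i i2 => -[].
  - by rewrite (_ : (Defs.i2 hn == i) = false) //; apply/negbTE; rewrite -val_eqE;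
       case: i i2 => -[|[]].
  by rewrite addbA addbb; case: x.
case=> [[i [j [i2 j2 ij ->]]]|].
  have ni k : k < 2 -> forall h : k < n, (Ordinal h == i) = false /\ (Ordinal h == j) = false.
    by move=> k2 h; rewrite -!val_eqE /=; split; apply/negbTE; move: k2 i2 j2; clear; lia.
  apply: sq => [||x]; rewrite ?wl_sigma /=.
  - by have [] := ni 0 isT (ltn_trans (isT : 0 < 3) hn) => // -> ->.
  - by have [] := ni 1%N isT (ltn_trans (isT : 1 < 3) hn) => // -> ->.
  case: x => k b /=; case: (eqVneq k i) => [->|ki]; last case: (eqVneq k j) => [->|kj].
  - by rewrite eq_sym (negPf ij) eqxx.
  - by rewrite eqxx.
  by rewrite (negPf ki) (negPf kj).
case=> [->|].
  exact: (@code_checkP (flatten (nseq 2 (flatten (nseq 2 [:: CEta; CTau 0]) ++ [:: CTau 1%N])))).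
case=> [->|].
  exact: (@code_checkP (flatten (nseq 4 [:: CEta; CSwap 0 2; CTau 1%N; CEta; CSwap 0 1%N]))).
case=> [->|].
  exact: (@code_checkP ([:: CSwap 0 1%N; CEta; CSwap 0 2; CTau 1%N; CEta; CSwap 0 1%N] ++
    flatten (nseq 2 [:: CSwap 1%N 2; CEta; CSwap 0 2; CTau 1%N; CEta]))).
case=> [->|[_ /feqP->]]; last exact: fext_id.
exact: (@code_checkP (flatten (nseq 4 [:: CSwap 0 3; CSwap 1%N 2; CEta]))).
Qed.

End Soundness.

(** The quotient needs a choice structure on words and a Boolean congruence; both are obtained
    classically. *)
HB.instance Definition _ (n : nat) := boolp.gen_eqMixin (gen n).
HB.instance Definition _ (n : nat) := boolp.gen_choiceMixin (gen n).

Section PresentedGroup.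
Variables (n : nat) (hn : 3 < n).
Implicit Types (r s t : gword n).

Let eqw := clos_refl_sym_trans _ (pres_step hn).

Lemma eqw_cat a b r s : eqw r s -> eqw (a ++ r ++ b) (a ++ s ++ b).
Proof.
elim=> [{}r {}s rs|{}r|{}r {}s _ IH|{}r {}s t _ IH1 _ IH2].
- apply: rst_step; case: rs => [u v x|u v p rel].
    by have := ps_free hn (a ++ u) (v ++ b) x; rewrite -!catA.
  by have := ps_rel (a ++ u) (v ++ b) rel; rewrite -!catA.
- exact: rst_refl.
- exact: rst_sym.
exact: rst_trans IH1 IH2.
Qed.

Definition pres_eq r s : bool := boolp.asbool (eqw r s).

Lemma pres_eqP r s : reflect (eqw r s) (pres_eq r s).
Proof. exact: boolp.asboolP. Qed.

Fact pres_eq_equiv : equiv_class_of pres_eq.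
Proof.
split=> [r|r s|s r t]; first exact/pres_eqP/rst_refl.
  by apply/pres_eqP/pres_eqP; apply: rst_sym.
by move=> /pres_eqP rs /pres_eqP st; apply/pres_eqP; apply: rst_trans st.
Qed.

Canonical pres_equiv_rel := EquivRelPack pres_eq_equiv.

Definition pgroup := {eq_quot pres_equiv_rel}%qT.

HB.instance Definition _ := Choice.on pgroup.

Definition cls r : pgroup := (\pi_({eq_quot pres_equiv_rel}) r)%qT.

Lemma cls_eq r s : cls r = cls s <-> eqw r s.
Proof. by split=> [/eqmodP/pres_eqP|/pres_eqP/eqmodP]. Qed.

Lemma cls_repr (x : pgroup) : cls (repr x) = x.
Proof. exact: reprK. Qed.

Let pmul (x y : pgroup) : pgroup := cls (repr x ++ repr y).
Let flip_gen (x : gen n * bool) := (x.1, ~~ x.2).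
Let pinv (x : pgroup) : pgroup := cls (rev (map flip_gen (repr x))).

Let cls_cat r s : pmul (cls r) (cls s) = cls (r ++ s).
Proof.
have repr_cls t : eqw (repr (cls t)) t by apply/cls_eq; rewrite cls_repr.
apply/cls_eq; apply: (@rst_trans _ _ _ (r ++ repr (cls s))).
  exact: (eqw_cat [::]).
by have := eqw_cat r [::] (repr_cls s); rewrite !cats0.
Qed.

Let eqw_cancel r : eqw (r ++ rev (map flip_gen r)) [::].
Proof.
elim: r => [|x r IH]; first exact: rst_refl.
rewrite /= rev_cons -cats1 catA.
apply: (@rst_trans _ _ _ ([:: x] ++ [::] ++ [:: flip_gen x])).
  by have := eqw_cat [:: x] [:: flip_gen x] IH.
by apply: rst_step; have := ps_free hn [::] [::] x.
Qed.

Let flip_genK : involutive flip_gen.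
Proof. by case=> x b; rewrite /flip_gen /= negbK. Qed.

Fact pmulA : associative pmul.
Proof.
move=> x y z; rewrite -(cls_repr x) -(cls_repr y) -(cls_repr z).
by rewrite !cls_cat catA.
Qed.
Fact pmul1 : left_id (cls [::]) pmul.
Proof. by move=> x; rewrite -(cls_repr x) cls_cat. Qed.
Fact pmulr1 : right_id (cls [::]) pmul.
Proof. by move=> x; rewrite -(cls_repr x) cls_cat cats0. Qed.
Fact pmulrV : right_inverse (cls [::]) pinv pmul.
Proof. by move=> x; rewrite -{1}(cls_repr x) cls_cat; apply/cls_eq. Qed.
Fact pmulV : left_inverse (cls [::]) pinv pmul.
Proof.
move=> x; rewrite -{2}(cls_repr x) cls_cat; apply/cls_eq.
have flipK : rev (map flip_gen (rev (map flip_gen (repr x)))) = repr x.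
  by rewrite map_rev revK -map_comp map_id_in // => y _ /=; apply: flip_genK.
by have := eqw_cancel (rev (map flip_gen (repr x))); rewrite flipK.
Qed.

HB.instance Definition _ := isGroup.Build pgroup pmulA pmul1 pmulr1 pmulV pmulrV.

Lemma clsM r s : cls (r ++ s) = cls r * cls s.
Proof. by rewrite -cls_cat. Qed.

Lemma cls_nil : cls [::] = 1. Proof. by []. Qed.

End PresentedGroup.

(** * The presented group satisfies the Steinberg relations *)

Section Presentation.
Variables (n : nat) (hn : 3 < n).
Implicit Types (r s : gword n).

Let G := pgroup hn.
Let iW (w : wn n) : G := cls hn [:: gW w].
Let e : G := cls hn [:: @gE n].

Lemma cls_wpow r k : cls hn (wpow r k) = cls hn r ^+ k.
Proof. by elim: k => [|k IH] //; rewrite expgS -IH -clsM. Qed.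

Lemma cls_relator r : is_relator hn r -> cls hn r = 1.
Proof.
move=> rel; apply/cls_eq/rst_step.
by have := ps_rel [::] [::] rel; rewrite cats0.
Qed.

Lemma eval_sound r s : clos_refl_sym_trans _ (pres_step hn) r s ->
  forall u, fext (eval_word r) u = fext (eval_word s) u.
Proof.
elim=> [{}r {}s rs|//|{}r {}s _ IH|{}r {}s t _ IH1 _ IH2] u.
- case: rs => [a b x|a b p rel]; rewrite !fext_gword; congr (fext _ _); last first.
    by rewrite (relator_sound _ rel).
  rewrite /= !fext_comp fext_id; case: x => [[w|] c] /=; last exact: (eta_sq hn).
  have wK : forall v, fext (w_endo w) (fext (w_endo (w_inv w)) v) = v.
    by apply: eq_fg_morph => // [v1 v2|i]; rewrite ?fextM // !fext_w wlV.
  have wVK : forall v, fext (w_endo (w_inv w)) (fext (w_endo w) v) = v.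
    by apply: eq_fg_morph => // [v1 v2|i]; rewrite ?fextM // !fext_w wlVK.
  by case: c => /=.
- by rewrite IH.
by rewrite IH1.
Qed.

Let act (x : G) : fgroup n -> fgroup n := fext (eval_word (repr x)).

Lemma act_cls r u : act (cls hn r) u = fext (eval_word r) u.
Proof. by apply: eval_sound; apply/(cls_eq hn); rewrite cls_repr. Qed.

Let actM g h u : act (g * h) u = act g (act h u).
Proof. by rewrite -(cls_repr g) -(cls_repr h) -clsM !act_cls fext_gword. Qed.

Let act1 u : act 1 u = u.
Proof. by rewrite -cls_nil act_cls fext_id. Qed.

Let actm g : {morph act g : u v / u * v}. Proof. exact: fextM. Qed.

Let act_W w x : act (iW w) (fgen x) = fgen (wl w x).
Proof. by rewrite act_cls /= fext_comp fext_id fext_w. Qed.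

Let act_e u : act e u = fext (@eta_endo n) u.
Proof. by rewrite act_cls /= fext_comp fext_id. Qed.

Let iWP (ws : seq (wn n)) : (forall x, foldr (@wl n) x ws = x) -> \prod_(w <- ws) iW w = 1.
Proof.
move=> wsP; have -> : \prod_(w <- ws) iW w = cls hn (map (@gW n) ws).
  by elim: ws {wsP} => [|w ws IH]; rewrite ?big_nil ?big_cons // IH -clsM.
apply: cls_relator; do 8!right; split; first by elim: ws {wsP}.
apply/feqP => u; rewrite fext_id; move: u.
apply: eq_fg_morph => // [u v|i]; first exact: fextM.
rewrite -[in RHS](wsP (i, false)); elim: ws {wsP} => [|w ws IH] /=; first by rewrite fext_id.
by rewrite fext_comp IH fext_w.
Qed.

Let r1 : e * e = 1.
Proof. by rewrite -clsM; apply: cls_relator; left. Qed.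

Let r2 : (iW (sigma (i1 hn) (i2 hn)) * e) ^+ 3 = 1.
Proof. by rewrite -clsM -cls_wpow; apply: cls_relator; right; left. Qed.

Let r3 (i : 'I_n) : 1 < i -> (e * iW (tau i)) ^+ 2 = 1.
Proof.
move=> i1; rewrite -clsM -cls_wpow; apply: cls_relator; do 2!right; left.
by exists i.
Qed.

Let r4 (i j : 'I_n) : 1 < i -> 1 < j -> i != j -> (e * iW (sigma i j)) ^+ 2 = 1.
Proof.
move=> i1 j1 ij; rewrite -clsM -cls_wpow; apply: cls_relator; do 3!right; left.
by exists i, j.
Qed.

Let s12 := [:: gW (sigma (i1 hn) (i2 hn))].
Let s13 := [:: gW (sigma (i1 hn) (i3 hn))].
Let s14 := [:: gW (sigma (i1 hn) (i4 hn))].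
Let s23 := [:: gW (sigma (i2 hn) (i3 hn))].
Let t1 := [:: gW (tau (i1 hn))].
Let t2 := [:: gW (tau (i2 hn))].
Let e' := [:: @gE n].

Let r5 : ((e * iW (tau (i1 hn))) ^+ 2 * iW (tau (i2 hn))) ^+ 2 = 1.
Proof.
have : cls hn (wpow (wpow (e' ++ t1) 2 ++ t2) 2) = 1.
  by apply: cls_relator; do 4!right; left.
by rewrite cls_wpow clsM cls_wpow clsM.
Qed.

Let r7 : iW (sigma (i1 hn) (i2 hn)) * e * iW (sigma (i1 hn) (i3 hn)) * iW (tau (i2 hn)) * e *
    iW (sigma (i1 hn) (i2 hn)) * (iW (sigma (i2 hn) (i3 hn)) * e *
      iW (sigma (i1 hn) (i3 hn)) * iW (tau (i2 hn)) * e) ^+ 2 = 1.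
Proof.
have : cls hn (((((s12 ++ e') ++ s13) ++ t2) ++ e') ++ s12 ++
    wpow ((((s23 ++ e') ++ s13) ++ t2) ++ e') 2) = 1.
  by apply: cls_relator; do 6!right; left.
by rewrite [X in X = _]clsM [cls _ (s12 ++ wpow _ _)]clsM cls_wpow !clsM !mulgA.
Qed.

Let r8 : (iW (sigma (i1 hn) (i4 hn)) * iW (sigma (i2 hn) (i3 hn)) * e) ^+ 4 = 1.
Proof.
have : cls hn (wpow ((s14 ++ s23) ++ e') 4) = 1.
  by apply: cls_relator; do 7!right; left.
by rewrite cls_wpow !clsM.
Qed.

Let Egen := transv hn iW e.

Let St : steinberg iW Egen := model_steinberg iWP r1 r2 r3 r4 r5 r7 r8.

Let Sa : steinberg_action iW Egen act.
Proof.
apply: (model_action iWP r1 r3 r4) => //.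
- by rewrite act_e eta1.
- by rewrite act_e eta2.
by move=> x x1 x2; rewrite act_e eta_out.
Qed.

(** Left multiplication by [W_n] keeps the norm, and [eta] is a signed permutation followed by one
    transvection, hence by one edge. *)
Lemma cls_gen_descends (x : gen n * bool) (g : G) :
  descends iW Egen act g -> descends iW Egen act (cls hn [:: x] * g).
Proof.
move=> dg; have eP : descends iW Egen act (e * g).
  rewrite (eta_transv hn iWP r1 r3 r4) -mulgA.
  have dt := descends_iW St Sa (tau (i2 hn)) dg.
  have i12 : (i1 hn, true).1 != (i2 hn, false).1 by [].
  exact: (descends_closed St Sa (edge_E St (iW (tau (i2 hn)) * g) i12) dt).
have eV : e^-1 = e by apply: mulg1_eq.
have clsV w : cls hn [:: (GW w, true)] = (iW w)^-1.
  apply/esym/mulg1_eq; rewrite -clsM; apply/cls_eq/rst_step.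
  exact: (ps_free hn [::] [::] (gW w)).
have eV' : cls hn [:: (GEta, true)] = e.
  rewrite -[RHS]eV; apply/esym/mulg1_eq; rewrite -clsM; apply/cls_eq/rst_step.
  exact: (ps_free hn [::] [::] (@gE n)).
case: x => [[w|] []]; rewrite ?clsV ?eV' //; last exact: descends_iW St Sa w g dg.
by rewrite (iWV St); apply: descends_iW.
Qed.

Lemma cls_descends r : descends iW Egen act (cls hn r).
Proof.
elim: r => [|x r IH]; first by rewrite cls_nil -(stW1 St); apply: descends_W.
by rewrite -cat1s clsM; apply: cls_gen_descends.
Qed.

Lemma kernel_trivial r : feq (eval_word r) (@id_endo n) -> pres_trivial hn r.
Proof.
move/feqP=> rid; apply/(cls_eq hn); rewrite cls_nil.
apply: (descends_faithful St Sa); first exact: cls_descends.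
by move=> u; rewrite act_cls rid fext_id.
Qed.

Lemma eval_surjective (f : endo n) : is_aut f -> exists w : gword n, feq (eval_word w) f.
Proof.
case=> f' [/feqP fK /feqP f'K].
have [||||g fg] := @act_surjective _ _ _ _ _ Sa (fext f) (fext f').
- exact: fextM.
- exact: fextM.
- by move=> u; rewrite -fext_comp f'K fext_id.
- by move=> u; rewrite -fext_comp fK fext_id.
by exists (repr g); apply/feqP => u; rewrite fg.
Qed.

End Presentation.

Theorem theorem1 (n : nat) (hn : 3 < n) :
  (* Aut(F_n) is generated by W_n and eta (the natural map is surjective) *)
  (forall f : endo n, is_aut f -> exists w : gword n, feq (eval_word w) f)
  /\
  (* the kernel of the natural map from the free group on the generators
     is exactly the normal closure of the relators *)
  (forall w : gword n, feq (eval_word w) (@id_endo n) <-> pres_trivial hn w).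
Proof.
split; first exact: eval_surjective.
move=> w; split; first exact: kernel_trivial.
by move/eval_sound=> wid; apply/feqP => u; rewrite wid.
Qed.
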